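(* Let $n$ be a positive integer and let $S$ be a nonempty, open, bounded and convex subset of $\mathbb{C}$ with $n$-fold symmetry about the origin, i.e. $e^{2\pi i/n}S=S$. Then for every $\alpha>-1$ there exist an analytic self-map $\phi$ of $\mathbb{D}$ and an analytic function $\psi$ on $\mathbb{D}$ such that $C_{\psi,\phi}$ is a bounded operator on $L^2_a(dA_\alpha)$ and $W(C_{\psi,\phi})=S$.
   Context: $\mathbb{D}$ is the open unit disc. $L^2_a(dA_\alpha)$ is the weighted Bergman space of analytic $f$ on $\mathbb{D}$ with $\int_{\mathbb{D}}|f|^2dA_\alpha<\infty$, $dA_{\alpha}(z)=(\alpha+1)(1-|z|^2)^{\alpha}dA(z)$, $dA$ normalized area measure. $C_{\psi,\phi}f=\psi\cdot(f\circ\phi)$. $W(T)=\{\langle Tf,f\rangle:\|f\|=1\}$. *)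

(* Defs.v *)
From HB Require Import structures.
From mathcomp Require Import all_boot all_order all_algebra.
From mathcomp Require Import all_classical all_reals all_analysis.
From mathcomp Require Export complex.
Export Order.TTheory GRing.Theory Num.Theory.
Export numFieldNormedType.Exports.

Set Implicit Arguments.
Unset Strict Implicit.
Unset Printing Implicit Defensive.

Local Open Scope ring_scope.
Local Open Scope classical_set_scope.
Local Open Scope complex_scope.

Section BergmanDefs.
Variable R : realType.

Local Notation C := (R[i])^o.

Definition cmod (z : R[i]) : R := ComplexField.Normc.normc z.

Definition udisc : set C := [set z | cmod z < 1].

Definition analytic_on (D : set C) (f : C -> C) : Prop :=
  forall z, D z -> derivable f z 1.

Definition toC (p : R * R) : C := p.1 +i* p.2.

Definition udisc2 : set (R * R) := [set p | udisc (toC p)].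

Definition leb2 := (@lebesgue_measure R \x @lebesgue_measure R)%E.

(* density of dA_alpha with respect to dx dy:
   dA_alpha = (alpha+1)(1-|z|^2)^alpha dA,  dA = dx dy / pi *)
Definition wdens (alpha : R) (p : R * R) : R :=
  (alpha + 1) * (1 - cmod (toC p) ^+ 2) `^ alpha / pi.

Definition bnorm2 (alpha : R) (f : C -> C) : \bar R :=
  (\int[leb2]_(p in udisc2) ((cmod (f (toC p))) ^+ 2 * wdens alpha p)%:E)%E.

Definition bnorm (alpha : R) (f : C -> C) : R := Num.sqrt (fine (bnorm2 alpha f)).

Definition L2a (alpha : R) (f : C -> C) : Prop :=
  analytic_on udisc f /\ (bnorm2 alpha f < +oo)%E.

Definition binner (alpha : R) (f g : C -> C) : C :=
  (Rintegral leb2 udisc2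
     (fun p => complex.Re (f (toC p) * conjc (g (toC p))) * wdens alpha p))
  +i*
  (Rintegral leb2 udisc2
     (fun p => complex.Im (f (toC p) * conjc (g (toC p))) * wdens alpha p)).

Definition wcomp (psi phi : C -> C) (f : C -> C) : C -> C :=
  fun z => psi z * f (phi z).

Definition bounded_op (alpha : R) (T : (C -> C) -> (C -> C)) : Prop :=
  (forall f, L2a alpha f -> L2a alpha (T f)) /\
  exists M : R, forall f, L2a alpha f -> bnorm alpha (T f) <= M * bnorm alpha f.

Definition numrange (alpha : R) (T : (C -> C) -> (C -> C)) : set C :=
  [set binner alpha (T f) f | f in [set f | L2a alpha f /\ bnorm alpha f = 1]].

Definition convex_setC (S : set C) : Prop :=
  forall z w t, S z -> S w -> 0 <= t <= 1 ->
    S (t%:C * z + (1 - t)%:C * w).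

Definition bounded_setC (S : set C) : Prop :=
  exists M : R, forall z, S z -> cmod z <= M.

Definition rootn (n : nat) : C :=
  cos (2 * pi / n%:R) +i* sin (2 * pi / n%:R).

End BergmanDefs.

(* Main.v *)
(** The self-map is the identity, so the operator is multiplication by [psi] and
    its numerical range is the set of averages of [psi] over the probability
    measures |f|^2 dA_alpha; the symmetry of [S] plays no role.

    The symbol is [psi = c 0 + sum_j (c (j+1) - c j) / (1 + 2^j (1 - z))], for a
    sequence [c] in [S] whose steps are small compared with the distance to the
    complement of [S].  With w = 1 - z in the right half-plane, 1 / (1 + 2^j w) is
    close to 1 when 2^j |w| is small and close to 0 when it is large, so the sum
    telescopes: [psi z] is close to [c J] as soon as 2^J |w| lies in [1, 2].  Hence
    [psi] maps the disc into [S]; as [c] comes close to every point of [S], so does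
    [psi] near suitable boundary points [om].

    The averages of [psi] stay in [S] because a point outside the open convex set
    [S] can be strictly separated from it.  Conversely, powers of (1 + conj om z) / 2
    concentrate their mass near [om], so the numerical range is dense in [S]; being
    convex (Toeplitz-Hausdorff), it contains the open set [S]. *)

Require Import Defs.
From HB Require Import structures.
From mathcomp Require Import all_boot all_order all_algebra.
From mathcomp Require Import all_classical all_reals all_analysis.
From mathcomp Require Import complex measurable_realfun zify ring lra.
Import Order.TTheory GRing.Theory Num.Theory.
Import numFieldNormedType.Exports.
Set Implicit Arguments.
Unset Strict Implicit.
Unset Printing Implicit Defensive.
Local Open Scope ring_scope.
Local Open Scope classical_set_scope.

(** * The modulus and complex differentiability *)

Section Modulus.
Local Open Scope complex_scope.
Variable R : realType.
Local Notation C := (R[i])^o.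
Implicit Types (z w : C).

(** The difficulty is to approach points close to the boundary of [S] without leaving [S]. The error
    in [psi z] is of the order of the steps of [c] at the scale of z, so these steps must shrink
    with the room left around [c J]. The path therefore makes excursions from a base point [s0]
    towards targets [p k] that are dense in [S]: at height h it stands at s0 + (1 - q^h)(p k - s0).
    Convexity leaves a disc of radius rho q^h around this point, and the steps there are at most a
    constant times (1 - q) q^h, so one choice of q close to 1 serves all heights and all targets.
    Heights change by at most one per step, so the bound on the steps changes by a factor of at most
    1/q <= 4/3 per scale, against the factor 1/2 gained from the kernels: scales at distance k from
    J contribute like (2/3)^k. Each target is visited infinitely often, by excursions of unbounded
    height. *)

Lemma cmod_sq z : cmod z ^+ 2 = complex.Re z ^+ 2 + complex.Im z ^+ 2.
Proof. by case: z => a b /=; rewrite sqr_sqrtr// addr_ge0// sqr_ge0. Qed.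

Lemma cmod_ge0 z : 0 <= cmod z.
Proof. by case: z => a b; exact: sqrtr_ge0. Qed.

Lemma cmodM z w : cmod (z * w) = cmod z * cmod w.
Proof. exact: ComplexField.Normc.normcM. Qed.

Lemma cmodV z : cmod z^-1 = (cmod z)^-1.
Proof. exact: ComplexField.Normc.normcV. Qed.

Lemma cmodD z w : cmod (z + w) <= cmod z + cmod w.
Proof. exact: le_normcD. Qed.

Lemma cmodN z : cmod (- z) = cmod z.
Proof. exact: normcN. Qed.

Lemma cmodE z : `|z| = (cmod z)%:C.
Proof. by []. Qed.

Lemma cmod_real (x : R) : cmod x%:C = `|x|.
Proof. by rewrite /cmod/= expr0n addr0 sqrtr_sqr. Qed.

Lemma Re_le_cmod z : `|complex.Re z| <= cmod z.
Proof.
rewrite -(ler_pXn2r (ltn0Sn 1)) ?nnegrE ?cmod_ge0// cmod_sq real_normK ?num_real//.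
by rewrite lerDl sqr_ge0.
Qed.

Lemma Im_le_cmod z : `|complex.Im z| <= cmod z.
Proof.
rewrite -(ler_pXn2r (ltn0Sn 1)) ?nnegrE ?cmod_ge0// cmod_sq real_normK ?num_real//.
by rewrite lerDr sqr_ge0.
Qed.

Lemma cmod_le_ReIm z : cmod z <= `|complex.Re z| + `|complex.Im z|.
Proof.
rewrite -(ler_pXn2r (ltn0Sn 1)) ?nnegrE ?cmod_ge0 ?addr_ge0// cmod_sq.
rewrite -(real_normK (num_real (complex.Re z))) -(real_normK (num_real (complex.Im z))).
have := normr_ge0 (complex.Re z); have := normr_ge0 (complex.Im z); nra.
Qed.

Lemma nbhsC (A : set C) z :
  nbhs z A <-> exists2 r : R, 0 < r & forall w, cmod (w - z) < r -> A w.
Proof.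
split.
- move=> /nbhs_ballP[e /= e0 eA].
  exists (complex.Re e); first by move: e0; rewrite ltcE/= => /andP[].
  move=> w wz; apply: eA; rewrite -ball_normE /= cmodE ltcE /=.
  move: e0; rewrite ltcE/= => /andP[/eqP-> _]; rewrite eqxx/=.
  by rewrite -cmodN opprB.
- move=> [r r0 rA]; apply/nbhs_ballP; exists r%:C => /=; first by rewrite ltcR.
  move=> w; rewrite -ball_normE /= cmodE ltcR => h; apply: rA.
  by rewrite -cmodN opprB.
Qed.

(** The difference quotient differs from [d] by at most K|h|. A quadratic remainder is asked for
    because it can be summed term by term over the kernel series. *)
Lemma derivable_quad (f : C -> C) z d K r : 0 < r ->
  (forall h, cmod h < r -> cmod (f (z + h) - f z - d * h) <= K * cmod h ^+ 2) ->
  derivable f z 1.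
Proof.
move=> r0 H.
have K0 : 0 <= K.
  have := H (r / 2)%:C; rewrite cmod_real ger0_norm ?divr_ge0 ?(ltW r0)//.
  have r2 : 0 < r / 2 by rewrite divr_gt0.
  move=> /(_ _)/wrap[]; first lra.
  move=> h; have := le_trans (cmod_ge0 _) h; rewrite pmulr_lge0// exprn_gt0//.
have K1 : 0 < K + 1 by lra.
apply/cvg_ex; exists (d : C).
apply/cvgrPdist_lt => e e0.
have e0' : 0 < complex.Re e by move: e0; rewrite ltcE/= => /andP[].
near=> h.
have h0 : h != 0 by near: h; exact: nbhs_dnbhs_neq.
rewrite cmodE ltcE /=; move: (e0); rewrite ltcE/= => /andP[/eqP-> _]; rewrite eqxx/=.
have hn : 0 < cmod h.
  rewrite lt_neqAle cmod_ge0 andbT eq_sym; apply: contra_neq h0.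
  exact: ComplexField.Normc.eq0_normc.
rewrite -(ltr_pM2r hn) -cmodM.
have -> : (d - h^-1 *: (f (h *: (1 : C) + z) - f z)) * h = - (f (z + h) - f z - d * h).
  rewrite -[h^-1 *: _]/(h^-1 * _) -[h *: _]/(h * _) mulr1 (addrC h z).
  by rewrite mulrBl (mulrAC h^-1) mulVf// mul1r [RHS]opprB.
rewrite cmodN; apply: (@le_lt_trans _ _ (K * cmod h ^+ 2)).
  apply: H; near: h; apply: nbhs_dnbhs; apply/nbhsC; exists r => // w.
  by rewrite subr0.
rewrite expr2 mulrA ltr_pM2r//.
apply: (@le_lt_trans _ _ ((K + 1) * cmod h)); first by rewrite ler_wpM2r ?(ltW hn)// lerDl.
rewrite mulrC -ltr_pdivlMr//.
near: h; apply: nbhs_dnbhs; apply/nbhsC; exists (complex.Re e / (K + 1)).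
  exact: divr_gt0.
by move=> w; rewrite subr0.
Unshelve. all: by end_near. Qed.

Lemma derivable_continuousC (f : C -> C) z : derivable f z 1 ->
  forall e : R, 0 < e ->
  exists2 r : R, 0 < r & forall w, cmod (w - z) < r -> cmod (f w - f z) < e.
Proof.
move=> /derivable1_diffP/differentiable_continuous/cvgrPdist_lt fz e e0.
have /fz/nbhsC[r r0 H] : 0 < e%:C by rewrite ltcR.
exists r => // w /H; rewrite cmodE ltcR -cmodN opprB; exact.
Qed.

End Modulus.

(** * Measurability and integration tools *)

Section Box_measurability.
Local Open Scope complex_scope.
Variable R : realType.

Definition box_open (A : set (R * R)) := forall p, A p ->
  exists2 r : R, 0 < r &
    forall q, `|q.1 - p.1| < r -> `|q.2 - p.2| < r -> A q.

(** Every point of [A] lies in a box with rational corners contained in [A]; there are countably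
    many such boxes, each measurable for the product sigma-algebra. *)
Lemma box_open_measurable (A : set (R * R)) : box_open A -> measurable A.
Proof.
move=> oA.
pose box (q : (rat * rat) * (rat * rat)) : set (R * R) :=
  `]ratr q.1.1, ratr q.1.2[%classic `*` `]ratr q.2.1, ratr q.2.2[%classic.
pose F q : set (R * R) := if pselect (box q `<=` A) then box q else set0.
have -> : A = \bigcup_q F q.
  apply/seteqP; split=> [p Ap|p [q _]]; last first.
    by rewrite /F; case: pselect => // qA /qA.
  have [r r0 rA] := oA _ Ap.
  have h (x : R) : exists ab : rat * rat,
      [/\ x - r < ratr ab.1, ratr ab.1 < x, x < ratr ab.2 & ratr ab.2 < x + r].
    have /rat_in_itvoo[a ax] : x - r < x by lra.
    move: ax; rewrite in_itv/= => /andP[a1 a2].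
    have /rat_in_itvoo[b bx] : x < x + r by lra.
    by move: bx; rewrite in_itv/= => /andP[b1 b2]; exists (a, b).
  have [ab [a1 a2 a3 a4]] := h (p.1 : R).
  have [cd [c1 c2 c3 c4]] := h p.2.
  exists (ab, cd) => //; rewrite /F; case: pselect.
    by move=> ?; split; rewrite /= in_itv/=; apply/andP.
  move=> nsub; exfalso; apply: nsub => q [/=]; rewrite !in_itv/= => /andP[q1 q2] /andP[q3 q4].
  by apply: rA; rewrite ltr_norml; lra.
apply: countable_bigcupT_measurable => [|q]; first exact: countableP.
rewrite /F; case: pselect => ? /=; last exact: measurable0.
by apply: measurableX; exact: measurable_itv.
Qed.

(** The preimages of the open rays above [a] are [box_open], and these rays generate the Borel
    sets. *)
Lemma box_continuous_measurable (D : set (R * R)) (u : R * R -> R) :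
  box_open D ->
  (forall p, D p -> forall e, 0 < e -> exists2 r : R, 0 < r &
    forall q, `|q.1 - p.1| < r -> `|q.2 - p.2| < r -> `|u q - u p| < e) ->
  measurable_fun D u.
Proof.
move=> oD cu; apply: (measurability _ (RGenOInfty.measurableE R)).
move=> _ [_ [a ->] <-]; apply: box_open_measurable => p [Dp /=].
rewrite in_itv/= andbT => aup.
have [r r0 rD] := oD _ Dp.
have [s s0 sD] : exists2 r : R, 0 < r & forall q,
    `|q.1 - p.1| < r -> `|q.2 - p.2| < r -> `|u q - u p| < u p - a.
  by apply: cu => //; rewrite subr_gt0.
exists (Num.min r s); first by rewrite lt_min r0.
move=> q; rewrite !lt_min => /andP[r1 s1] /andP[r2 s2]; split; first exact: rD.
rewrite /= in_itv/= andbT; have := sD q s1 s2; rewrite ltr_norml => /andP[]; lra.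
Qed.

(** [f] may blow up at both endpoints. The fundamental theorem applies on compact subintervals
    exhausting the open one, each integral is a difference of two values of [F], and monotone
    convergence passes the bound to the limit. *)
Lemma ge0_FTC_open_le (f F : R -> R) (u v M : R) : u < v ->
  (forall x, u < x < v -> 0 <= f x) ->
  (forall x, u < x < v -> {for x, continuous f}) ->
  (forall x, u < x < v -> is_derive x 1 F (f x)) ->
  (forall x, u < x < v -> `|F x| <= M) ->
  (\int[@lebesgue_measure R]_(x in `]u, v[%classic) (f x)%:E <= (2 * M)%:E)%E.
Proof.
move=> uv f0 cf dF FM.
(* With 3 in the denominator, u + d n < v - d n already for n = 0. *)
pose d n : R := (v - u) / (n%:R + 3).
have d0 n : 0 < d n by rewrite divr_gt0 ?subr_gt0// ltr_wpDl.
have d3 n : d n * 3 <= v - u.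
  rewrite /d mulrAC -mulrA ler_piMr ?subr_ge0 ?(ltW uv)//.
  by rewrite ler_pdivrMr ?mul1r ?lerDr// ltr_wpDl.
pose E n : set R := `[u + d n, v - d n]%classic.
have sub n x : E n x -> u < x < v.
  rewrite /E/= !in_itv/= => /andP[? ?].
  by have dn := d0 n; apply/andP; split; lra.
have -> : `]u, v[%classic = \bigcup_n E n.
  apply/seteqP; split=> [x|x [n _ /sub]]; last by rewrite /= in_itv.
  rewrite /= in_itv/= => /andP[ux xv].
  pose m := Num.min (x - u) (v - x).
  have m0 : 0 < m by rewrite lt_min !subr_gt0 ux.
  have [n nP] : exists n : nat, d n <= m.
    exists (Num.truncn ((v - u) / m)).+1; rewrite /d ler_pdivrMr ?ltr_wpDl//.
    rewrite mulrC -ler_pdivrMr//.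
    apply: (le_trans (ltW (truncnS_gt _))); by rewrite lerDl.
  exists n => //; rewrite /E /= in_itv/=; move: nP; rewrite le_min.
  by move=> /andP[? ?]; apply/andP; split; lra.
have mf : measurable_fun (`]u, v[%classic : set R) f.
  by apply: open_continuous_measurable_fun => // x; rewrite inE/= in_itv/=; exact: cf.
have cvE : (\int[@lebesgue_measure R]_(x in E n) (f x)%:E @[n --> \oo] -->
    \int[@lebesgue_measure R]_(x in \bigcup_n E n) (f x)%:E)%E.
  apply: ge0_nondecreasing_set_cvg_integral.
  - move=> m n mn; apply/subsetPset => x; rewrite /E/= !in_itv/= => /andP[h1 h2].
    have dmn : d n <= d m.
      rewrite ler_wpM2l ?subr_ge0 ?(ltW uv)// lef_pV2 ?posrE ?ltr_wpDl//.
      by rewrite lerD2r ler_nat.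
    by apply/andP; split; lra.
  - by move=> n; exact: measurable_itv.
  - move=> n; apply/measurable_EFinP; apply: measurable_funS mf => //.
    by move=> x /sub; rewrite /= in_itv.
  - by move=> n x /sub xuv; rewrite lee_fin f0.
rewrite -(cvg_lim _ cvE)//; apply: lime_le; first by apply/cvg_ex; eexists; exact: cvE.
apply: nearW => n.
have ab : u + d n < v - d n by have := d0 n; have := d3 n; lra.
have Esub x : u + d n <= x <= v - d n -> u < x < v.
  by move=> h; apply: (sub n); rewrite /E/= in_itv.
have dFc x : u + d n <= x <= v - d n -> {for x, continuous F}.
  move=> /Esub/dF h; apply: differentiable_continuous; apply/derivable1_diffP.
  exact: ex_derive.
rewrite (@continuous_FTC2 _ f F).
- rewrite -EFinB lee_fin.
  have /FM : u < v - d n < v by apply: Esub; rewrite lexx ltW.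
  have /FM : u < u + d n < v by apply: Esub; rewrite lexx ltW.
  rewrite !ler_norml => /andP[? ?] /andP[? ?]; lra.
- exact: ab.
- apply: continuous_in_subspaceT => x; rewrite inE/= in_itv/= => /Esub; exact: cf.
- split.
  + move=> x; rewrite in_itv/= => /andP[xa xb]; have /dF h : u < x < v.
      by apply: Esub; rewrite !ltW.
    exact: ex_derive.
  + apply: cvg_at_right_filter; apply: dFc; by rewrite lexx ltW.
  + apply: cvg_at_left_filter; apply: dFc; by rewrite lexx ltW.
- move=> x; rewrite in_itv/= => /andP[xa xb]; have /dF h : u < x < v.
    by apply: Esub; rewrite !ltW.
  by rewrite derive1E derive_val.
Qed.

End Box_measurability.

Section Power_integral.
Local Open Scope complex_scope.
Variable R : realType.
Local Notation C := (R[i])^o.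

(** The integrand is one of (a + y)^(-b) and (a - y)^(-b), hence at most their sum; since b < 1,
    both have primitives bounded by (2a)^(1-b) / (1-b). *)
Lemma powR_sym_integral (a b : R) : 0 < a -> 0 < b < 1 ->
  (\int[@lebesgue_measure R]_(y in `](- a)%R, a[%classic)
     ((a - `|y|) `^ (- b))%R%:E <= (8 / (1 - b) * a `^ (1 - b))%R%:E)%E.
Proof.
move=> a0 /andP[b0 b1].
have b1' : 1 - b != 0 by rewrite gt_eqF// subr_gt0.
pose M := (2 * a) `^ (1 - b) / (1 - b).
have mpow (s : R) : measurable_fun (`](- a), a[%classic : set R)
    (fun y => (a + s * y) `^ (- b)).
  apply: measurable_funTS.
  apply: (measurableT_comp (measurable_powR (- b))).
  by apply: measurable_funD => //; apply: measurable_funM.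
have part (s : R) : s = 1 \/ s = -1 ->
    (\int[@lebesgue_measure R]_(y in `](- a)%R, a[%classic)
     ((a + s * y) `^ (- b))%R%:E <= (2 * M)%:E)%E.
  move=> s1.
  have pos y : - a < y < a -> 0 < a + s * y by case: s1 => ->; lra.
  have s2 : s * s = 1 by case: s1 => ->; lra.
  have der y : - a < y < a -> is_derive y (1 : R)
      (fun y => s / (1 - b) * (a + s * y) `^ (1 - b)) ((a + s * y) `^ (- b)).
    move=> ya.
    have h := @is_derive1_powR R (1 - b) (a + s * y) (pos _ ya).
    have h2 : is_derive y (1 : R) (fun y => a + s * y) s.
      by apply: is_derive_eq; rewrite /GRing.scale/=; ring.
    have h3 := @is_derive1_comp R (fun x => x `^ (1 - b)) (fun y => a + s * y) y _ _ h h2.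
    apply: is_derive_eq; rewrite /GRing.scale/=.
    rewrite [1 - b - 1](_ : _ = - b); last by ring.
    set P := _ `^ (- b); set D := 1 - b in b1' *.
    rewrite -[LHS]/(s * D^-1 * (D * P * s) : R).
    by rewrite (_ : _ * _ = (s * s) * (D * D^-1) * P); [rewrite s2 mulfV// !mul1r|ring].
  apply: (@ge0_FTC_open_le _ _ (fun y => s / (1 - b) * (a + s * y) `^ (1 - b))) => //.
  - lra.
  - by move=> y _; exact: powR_ge0.
  - move=> y ya; apply: (@continuous_comp _ _ _ (fun y => a + s * y) (fun x => x `^ (- b))).
      by apply: cvgD; [exact: cvg_cst|apply: cvgM; [exact: cvg_cst|exact: cvg_id]].
    apply: differentiable_continuous; apply/derivable1_diffP.
    by apply: derivable_powR; rewrite in_itv/= andbT; exact: pos.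
  - move=> y ya; rewrite !normrM (_ : `|s| = 1); last first.
      by case: s1 => ->; rewrite ?normrN normr1.
    rewrite mul1r ger0_norm ?invr_ge0 ?subr_ge0 ?(ltW b1)// ger0_norm ?powR_ge0//.
    rewrite mulrC /M ler_wpM2r ?invr_ge0 ?subr_ge0 ?(ltW b1)//.
    apply: ge0_ler_powR; rewrite ?nnegrE ?subr_ge0 ?(ltW b1)// ?(ltW (pos _ ya))//.
      lra.
    by case: s1 => ->; lra.
have M4 : 2 * M + 2 * M <= 8 / (1 - b) * a `^ (1 - b).
  rewrite /M powRM ?(ltW a0)//.
  have two : (2 : R) `^ (1 - b) <= 2.
    by rewrite -[leRHS]powRr1//; apply: ler_powR; lra.
  have := powR_ge0 a (1 - b); set A := a `^ _ => A0.
  have i0 : 0 < (1 - b)^-1 by rewrite invr_gt0 subr_gt0.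
  set B := _ `^ _ in two *; set I := _^-1 in i0 *.
  have : (2 - B) * (A * I) >= 0 by rewrite mulr_ge0 ?mulr_ge0 ?(ltW i0)// subr_ge0.
  lra.
apply: (@le_trans _ _ (2 * M + 2 * M)%:E); last by rewrite lee_fin.
rewrite EFinD; apply: le_trans; last first.
  by apply: leeD; [apply: (part 1); left|apply: (part (-1)); right].
rewrite -ge0_integralD//=; last 4 first.
- by move=> y _; rewrite lee_fin powR_ge0.
- by apply/measurable_EFinP; exact: mpow.
- by move=> y _; rewrite lee_fin powR_ge0.
- by apply/measurable_EFinP; exact: mpow.
apply: ge0_le_integral => //=.
- by move=> y _; rewrite lee_fin powR_ge0.
- apply/measurable_EFinP; apply: measurable_funTS.
  apply: (measurableT_comp (measurable_powR (- b))).
  by apply: measurable_funB => //; exact: normr_measurable.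
- by apply: emeasurable_funD; apply/measurable_EFinP; exact: mpow.
- move=> y _; rewrite lee_fin mul1r mulN1r.
  by have [y0|y0] := ger0P y; rewrite ?opprK ?lerDr ?lerDl powR_ge0.
Qed.

End Power_integral.

(** * The weight on the disc *)

Section Disc_weight.
Local Open Scope complex_scope.
Variable R : realType.
Local Notation C := (R[i])^o.
Implicit Types (p q : R * R) (f g : C -> C).

Lemma cmod_toC p : cmod (toC p) ^+ 2 = p.1 ^+ 2 + p.2 ^+ 2.
Proof. by rewrite cmod_sq. Qed.

Lemma udisc2E p : udisc2 p <-> p.1 ^+ 2 + p.2 ^+ 2 < 1.
Proof.
rewrite -cmod_toC /udisc2/udisc/=.
by rewrite expr_lt1// cmod_ge0.
Qed.

Lemma box_open_udisc2 : box_open (@udisc2 R).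
Proof.
move=> [x y] /udisc2E/= xy1.
have x1 : `|x| <= 1.
  rewrite -(@expr_le1 _ 2)// real_normK ?num_real//; nra.
have y1 : `|y| <= 1.
  rewrite -(@expr_le1 _ 2)// real_normK ?num_real//; nra.
pose m := 1 - (x ^+ 2 + y ^+ 2).
have m0 : 0 < m by rewrite subr_gt0.
have m1 : m <= 1 by rewrite /m; nra.
(* Each squared coordinate grows by at most m / 4 + m / 64, and twice this is below m. *)
exists (m / 8); first by rewrite divr_gt0.
have key (u a : R) : `|u| <= 1 -> `|a - u| < m / 8 -> a ^+ 2 <= u ^+ 2 + m / 4 + m / 64.
  rewrite ler_norml ltr_norml (_ : a ^+ 2 = (u + (a - u)) ^+ 2); last by ring.
  move: (a - u) => d /andP[? ?] /andP[? ?].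
  have : d ^+ 2 <= m / 64 by nra.
  have : u * d <= m / 8 by nra.
  nra.
move=> [a b] /= /(key _ _ x1) ax /(key _ _ y1) bY; apply/udisc2E => /=.
move: ax bY m0; rewrite /m; lra.
Qed.

Lemma measurable_udisc2 : measurable (@udisc2 R).
Proof. by apply: box_open_measurable; exact: box_open_udisc2. Qed.

Lemma analytic_box_continuous f p : analytic_on (@udisc R) f -> udisc2 p ->
  forall e, 0 < e -> exists2 r : R, 0 < r & forall q,
    `|q.1 - p.1| < r -> `|q.2 - p.2| < r -> cmod (f (toC q) - f (toC p)) < e.
Proof.
move=> af Dp e e0.
have [r r0 H] := derivable_continuousC (af _ Dp) e0.
exists (r / 2); first by rewrite divr_gt0.
move=> q q1 q2; apply: H; apply: le_lt_trans (cmod_le_ReIm _) _; rewrite /=; lra.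
Qed.

Lemma measurable_Re f : analytic_on (@udisc R) f ->
  measurable_fun (@udisc2 R) (fun p => complex.Re (f (toC p))).
Proof.
move=> af; apply: (box_continuous_measurable (@box_open_udisc2)) => p Dp e e0.
have [r r0 H] := analytic_box_continuous af Dp e0.
exists r => // q q1 q2; apply: le_lt_trans (H q q1 q2).
by rewrite -raddfB; exact: Re_le_cmod.
Qed.

Lemma measurable_Im f : analytic_on (@udisc R) f ->
  measurable_fun (@udisc2 R) (fun p => complex.Im (f (toC p))).
Proof.
move=> af; apply: (box_continuous_measurable (@box_open_udisc2)) => p Dp e e0.
have [r r0 H] := analytic_box_continuous af Dp e0.
exists r => // q q1 q2; apply: le_lt_trans (H q q1 q2).
by rewrite -raddfB; exact: Im_le_cmod.
Qed.

Lemma measurable_wdens (alpha : R) : measurable_fun (@udisc2 R) (wdens alpha).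
Proof.
apply: measurable_funTS; rewrite /wdens.
apply: measurable_funM => //; apply: measurable_funM => //.
apply: (measurableT_comp (measurable_powR alpha)).
apply: measurable_funB => //.
rewrite (_ : (fun x => _) = (fun p => p.1 ^+ 2 + p.2 ^+ 2)); last first.
  by apply/funext => p; rewrite cmod_toC.
by apply: measurable_funD; apply: measurable_funX.
Qed.

Lemma wdens_ge0 (alpha : R) p : -1 < alpha -> 0 <= wdens alpha p.
Proof.
move=> a1; rewrite /wdens divr_ge0 ?pi_ge0// mulr_ge0 ?powR_ge0//; lra.
Qed.

Lemma wdens_gt0 (alpha : R) p : -1 < alpha -> udisc2 p -> 0 < wdens alpha p.
Proof.
move=> a1 /udisc2E Dp; rewrite /wdens divr_gt0 ?pi_gt0// mulr_gt0//; first lra.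
by rewrite powR_gt0// cmod_toC subr_gt0.
Qed.

(** With c = sqrt(1 - x^2), 1 - x^2 - y^2 = (c - |y|)(c + |y|) >= c (c - |y|). So the inner integral
    of the power -b is at most a constant times c^(-b) c^(1-b) = c^(1-2b) <= c^(-1) <= (1 -
    |x|)^(-1/2), which is integrable in x. *)
Lemma wdens_finite (alpha : R) : -1 < alpha ->
  (\int[@leb2 R]_(p in @udisc2 R) (wdens alpha p)%:E < +oo)%E.
Proof.
move=> a1.
(* Since 0 < 1 - |z|^2 <= 1, an exponent -b <= alpha bounds the weight from above; the value 1/2
   keeps b positive when alpha >= 0, as [powR_sym_integral] requires. *)
pose b : R := Num.max (1 / 2) (- alpha).
have b12 : 1 / 2 <= b by rewrite le_max lexx.
have ba : - b <= alpha by rewrite lerNl le_max lexx orbT.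
have b1 : b < 1 by rewrite gt_max; apply/andP; split; lra.
have b01 : 0 < b < 1 by apply/andP; split; lra.
pose k := (alpha + 1) / pi.
have k0 : 0 <= k by rewrite divr_ge0 ?pi_ge0//; lra.
pose W : R * R -> \bar R := (fun p => (wdens alpha p)%:E) \_ (@udisc2 R).
have W0 p : (0 <= W p)%E.
  by apply: erestrict_ge0 => ? _; rewrite lee_fin wdens_ge0.
have mW : measurable_fun setT W.
  apply/(measurable_restrictT _ _).1; first exact: measurable_udisc2.
  by apply/measurable_EFinP; exact: measurable_wdens.
rewrite integral_mkcond; have E := @fubini_tonelli1 _ _ _ _ _ (@lebesgue_measure R) (@lebesgue_measure R) W mW W0. rewrite [X in (X < _)%E]E.

pose K := k * (8 / (1 - b)).
have K0 : 0 <= K by rewrite mulr_ge0// divr_ge0//; lra.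
pose h (x : R) : \bar R := (K * (1 - `|x|) `^ (- (1 / 2)))%R%:E.
pose h1 : R -> \bar R := h \_ (`](-1), 1[%classic).
have mh : measurable_fun (`](-1)%R, 1%R[%classic : set R) h.
  apply/measurable_EFinP; apply: measurable_funTS; apply: measurable_funM => //.
  apply: (measurableT_comp (measurable_powR (- (1 / 2)))).
  by apply: measurable_funB => //; exact: normr_measurable.
have h0 x : (0 <= h x)%E by rewrite lee_fin mulr_ge0// powR_ge0.
apply: (@le_lt_trans _ _ (\int[@lebesgue_measure R]_x h1 x)%E); last first.
  rewrite -integral_mkcond /h.
  under eq_integral do rewrite EFinM.
  rewrite ge0_integralZl_EFin//; last 2 first.
  - by move=> x _; rewrite lee_fin powR_ge0.
  - apply/measurable_EFinP; apply: measurable_funTS.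
    apply: (measurableT_comp (measurable_powR (- (1 / 2)))).
    by apply: measurable_funB => //; exact: normr_measurable.
  apply: (@le_lt_trans _ _ (K%:E * (8 / (1 - 1 / 2) * 1 `^ (1 - 1 / 2))%R%:E)%E).
    by apply: lee_wpmul2l; rewrite ?lee_fin//; apply: powR_sym_integral; lra.
  by rewrite -EFinM ltry.
apply: ge0_le_integral => //.
- by move=> x _; apply: integral_ge0.
- exact: measurable_fun_fubini_tonelli_F.
- by apply/(measurable_restrictT _ _).1 => //; exact: measurable_itv.
move=> x _; rewrite /fubini_F /h1 patchE; case: ifPn => xin; last first.
  rewrite integral0_eq// => y _; rewrite /W patchE; case: ifPn => //.
  rewrite inE => /udisc2E/= xy; exfalso; move: xin; rewrite notin_setE/= in_itv/=; apply.
  by rewrite -ltr_norml -(@expr_lt1 _ 2)// real_normK ?num_real//; nra.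
move: xin; rewrite inE/= in_itv/= => /andP[xm1 x1].
pose c := Num.sqrt (1 - x ^+ 2).
have x2 : 0 < 1 - x ^+ 2 by nra.
have c0 : 0 < c by rewrite sqrtr_gt0.
have cc : c ^+ 2 = 1 - x ^+ 2 by rewrite sqr_sqrtr// ltW.
have c1 : c <= 1 by nra.
pose G (y : R) : \bar R := (k * c `^ (- b) * (c - `|y|) `^ (- b))%R%:E.
have mG0 : measurable_fun (`](- c)%R, c%R[%classic : set R) (fun y : R => (c - `|y|) `^ (- b)).
  apply: measurable_funTS; apply: (measurableT_comp (measurable_powR (- b))).
  by apply: measurable_funB => //; exact: normr_measurable.
have mG : measurable_fun (`](- c)%R, c%R[%classic : set R) G.
  by apply/measurable_EFinP; apply: measurable_funM.
apply: (@le_trans _ _ (\int[@lebesgue_measure R]_(y in `](- c)%R, c%R[%classic) G y)%E).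
  rewrite [leRHS]integral_mkcond; apply: ge0_le_integral => //.
  - exact: measurableT_comp.
  - by apply/(measurable_restrictT _ _).1 => //; exact: measurable_itv.
  move=> y _; rewrite /W patchE; case: ifPn => Dy; last first.
    suff : (0 <= (G \_ (`](- c)%R, c[%classic : set R)) y)%E by [].
    by apply: erestrict_ge0 => ? _; rewrite lee_fin; apply: mulr_ge0; [apply: mulr_ge0 => //|]; exact: powR_ge0.
  move: Dy; rewrite inE => /[dup] /udisc2E/= xy Dxy.
  have yc : `|y| < c.
    rewrite ltNge; apply/negP => cy.
    have : `|y| ^+ 2 = y ^+ 2 by rewrite real_normK// num_real.
    by nra.
  rewrite patchE ifT; last by rewrite inE/= in_itv/= -ltr_norml.
  rewrite /G lee_fin /wdens cmod_toC/=.
  have yy : `|y| ^+ 2 = y ^+ 2 by rewrite real_normK// num_real.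
  have bd : 0 < 1 - (x ^+ 2 + y ^+ 2) <= 1 by apply/andP; split; nra.
  rewrite mulrAC -/k -mulrA ler_wpM2l//.
  apply: le_trans (ger_powR bd ba) _.
  rewrite -powRM ?(ltW c0) ?subr_ge0 ?(ltW yc)//.
  have P1 : 0 < c * (c - `|y|) by rewrite mulr_gt0// subr_gt0.
  have P2 : 0 < 1 - (x ^+ 2 + y ^+ 2) by case/andP: bd.
  rewrite !powRN lef_pV2 ?posrE ?powR_gt0//.
  apply: ge0_ler_powR; rewrite ?nnegrE ?(ltW P1) ?(ltW P2)//; first lra.
  by have := normr_ge0 y; nra.
rewrite /G.
under eq_integral do rewrite EFinM.
rewrite ge0_integralZl_EFin//; last 3 first.
- by move=> y _; rewrite lee_fin powR_ge0.
- exact/measurable_EFinP.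
- by apply: mulr_ge0 => //; exact: powR_ge0.
apply: (@le_trans _ _ ((k * c `^ (- b))%:E * (8 / (1 - b) * c `^ (1 - b))%R%:E)%E).
  apply: lee_wpmul2l; last exact: powR_sym_integral.
  by rewrite lee_fin; apply: mulr_ge0 => //; exact: powR_ge0.
rewrite -EFinM lee_fin /K.
rewrite mulrACA.
rewrite ler_wpM2l// -powRD; last by apply/implyP => _; rewrite gt_eqF.
apply: (@le_trans _ _ (c `^ (- 1))).
  by apply: ger_powR; [rewrite c0|lra].
rewrite !powRN lef_pV2 ?posrE ?powR_gt0//; last by rewrite subr_gt0 ltr_norml xm1.
rewrite powRr1 ?(ltW c0)// (_ : 1 / 2 = 2^-1); last by rewrite mul1r.
rewrite powR12_sqrt; last by rewrite subr_ge0 ltW// ltr_norml xm1.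
apply: ler_wsqrtr; have : `|x| ^+ 2 = x ^+ 2 by rewrite real_normK// num_real.
have : `|x| < 1 by rewrite ltr_norml xm1.
have := normr_ge0 x; nra.
Qed.

End Disc_weight.

(** * Integrals against the weight *)

Section Weighted_integral.
Local Open Scope complex_scope.
Variable R : realType.
Local Notation C := (R[i])^o.
Implicit Types (p q : R * R) (f g h : C -> C).
Local Notation analytic := (analytic_on (@udisc R)).

Lemma analytic_cst (c : C) : analytic (fun _ => c).
Proof. by move=> z _; exact: derivable_cst. Qed.

Lemma analytic_id : analytic (fun z => z).
Proof. by move=> z _; exact: derivable_id. Qed.

Lemma analyticD f g : analytic f -> analytic g -> analytic (fun z => f z + g z).
Proof. by move=> af ag z Dz; apply: derivableD; [exact: af|exact: ag]. Qed.

Lemma analyticM f g : analytic f -> analytic g -> analytic (fun z => f z * g z).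
Proof. by move=> af ag z Dz; apply: derivableM; [exact: af|exact: ag]. Qed.

Lemma analyticX f n : analytic f -> analytic (fun z => f z ^+ n).
Proof.
move=> af; elim: n => [|n ih].
  have -> : (fun z => f z ^+ 0) = (fun _ => 1) by apply/funext => z; rewrite expr0.
  exact: analytic_cst.
have -> : (fun z => f z ^+ n.+1) = (fun z => f z * f z ^+ n).
  by apply/funext => z; rewrite exprS.
exact: analyticM.
Qed.

Local Notation T := (measurableTypeR R * measurableTypeR R)%type.

(** [leb2] with the type of a measure on [T], the form in which the integration lemmas accept it. *)
Definition lebm : {measure set T -> \bar R} :=
  (@lebesgue_measure R \x @lebesgue_measure R)%E.

Variable alpha : R.
Hypothesis a1 : -1 < alpha.

Local Notation w := (@wdens R alpha : T -> R).
Local Notation D := (@udisc2 R : set T).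
Local Notation mu := lebm.

Definition wintegrable (u : T -> R) : Prop := mu.-integrable D (EFin \o (fun p => u p * w p)).
Definition wint (u : T -> R) : R := \int[mu]_(p in D) (u p * w p).
Local Notation intw := wintegrable.
Local Notation Iw := wint.
Let mD : measurable D := @measurable_udisc2 R.
Implicit Types u v : T -> R.


Lemma measurable_mulw (u : T -> R) : measurable_fun D u -> measurable_fun D (fun p => u p * w p).
Proof. by move=> mu'; apply: measurable_funM => //; exact: measurable_wdens. Qed.

Lemma intw_dom (u v : T -> R) : measurable_fun D u -> intw v ->
  (forall p, D p -> `|u p| <= v p) -> intw u.
Proof.
move=> mu' iv uv; apply: le_integrable iv => //.
  by apply/measurable_EFinP; exact: measurable_mulw.
move=> p Dp /=; rewrite lee_fin !normrM ler_wpM2r//.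
by apply: le_trans (uv p Dp) _; exact: ler_norm.
Qed.

Lemma intw_cst (k : R) : intw (fun _ => k).
Proof.
have i1 : intw (fun=> 1).
  apply/integrableP; split.
    by apply/measurable_EFinP; exact: measurable_mulw.
  rewrite [ltLHS](_ : _ = \int[mu]_(p in D) (w p)%:E)%E; first exact: wdens_finite.
  by apply: eq_integral => p _ /=; rewrite mul1r ger0_norm// wdens_ge0.
have := integrableZl mD k i1; rewrite /wintegrable; congr (integrable _ _ _).
by apply/funext => p /=; rewrite mul1r EFinM.
Qed.

Lemma intwD u v : intw u -> intw v -> intw (fun p => u p + v p).
Proof.
move=> iu iv; have := integrableD mD iu iv; rewrite /wintegrable; congr (integrable _ _ _).
by apply/funext => p /=; rewrite mulrDl EFinD.
Qed.

Lemma intwZ k u : intw u -> intw (fun p => k * u p).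
Proof.
move=> iu; have := integrableZl mD k iu; rewrite /wintegrable; congr (integrable _ _ _).
by apply/funext => p /=; rewrite -mulrA EFinM.
Qed.

Lemma eq_Iw u v : (forall p, D p -> u p = v p) -> Iw u = Iw v.
Proof. by move=> uv; apply: eq_Rintegral => p /set_mem Dp; rewrite uv. Qed.

Lemma IwD u v : intw u -> intw v -> Iw (fun p => u p + v p) = Iw u + Iw v.
Proof.
move=> iu iv; rewrite /wint -RintegralD//.
by apply: eq_Rintegral => p _; rewrite mulrDl.
Qed.

Lemma IwZ k u : intw u -> Iw (fun p => k * u p) = k * Iw u.
Proof.
move=> iu; rewrite /wint -RintegralZl//.
by apply: eq_Rintegral => p _; rewrite mulrA.
Qed.

Lemma le_Iw u v : intw u -> intw v -> (forall p, D p -> u p <= v p) -> Iw u <= Iw v.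
Proof.
move=> iu iv uv; apply: le_Rintegral => // p Dp.
by rewrite ler_wpM2r ?wdens_ge0// uv.
Qed.

(** The weight is positive on the disc, so it cancels from the product that vanishes almost
    everywhere. *)
Lemma Iw_eq0 u : intw u -> (forall p, D p -> 0 <= u p) -> Iw u = 0 ->
  {ae mu, forall p, D p -> u p = 0}.
Proof.
move=> iu u0 I0.
have mu' : measurable_fun D (EFin \o (fun p => u p * w p)) by case/integrableP: iu.
have : (\int[mu]_(p in D) `|(u p * w p)%:E| = 0)%E.
  rewrite (_ : \int[mu]_(p in D) _ = \int[mu]_(p in D) (u p * w p)%:E)%E; last first.
    apply: eq_integral => p /set_mem Dp /=.
    by rewrite ger0_norm// mulr_ge0 ?u0// wdens_ge0.
  have fi := integrable_fin_num mD iu.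
  by rewrite -(fineK fi) -[fine _]/(Iw u) I0.
move/(ae_eq_integral_abs mu mD mu'); have F := ae_filter_ringOfSetsType mu; apply: (@filterS _ _ F) => p h Dp.
by have := h Dp => /= -[] /eqP; rewrite mulf_eq0 (gt_eqF (wdens_gt0 a1 Dp)) orbF => /eqP.
Qed.

Lemma ae0_Iw u : intw u -> {ae mu, forall p, D p -> u p = 0} -> Iw u = 0.
Proof.
move=> iu u0; have F := ae_filter_ringOfSetsType mu; rewrite /wint /Rintegral (@ae_eq_integral _ _ _ mu D (cst 0%E))//.
- by rewrite integral0.
- by case/integrableP: iu.
- by apply: (@filterS _ _ F _ _ _ u0) => p h Dp /=; rewrite h// mul0r.
Qed.

End Weighted_integral.

(** * Complex integrals and the Bergman space *)

Section Bergman_space.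
Local Open Scope complex_scope.
Variables (R : realType) (alpha : R).
Hypothesis a1 : -1 < alpha.
Local Notation C := (R[i])^o.
Local Notation T := (measurableTypeR R * measurableTypeR R)%type.
Local Notation analytic := (analytic_on (@udisc R)).
Local Notation w := (@wdens R alpha : T -> R).
Local Notation D := (@udisc2 R : set T).
Local Notation mu := (@lebm R).
Local Notation intw := (wintegrable alpha).
Local Notation Iw := (wint alpha).
Implicit Types (p q : T) (f g h u v : C -> C).

Definition CI u : C :=
  Iw (fun p => complex.Re (u (toC p))) +i* Iw (fun p => complex.Im (u (toC p))).

Definition cint u : Prop :=
  intw (fun p => complex.Re (u (toC p))) /\ intw (fun p => complex.Im (u (toC p))).

Lemma eq_CI u v : (forall p, D p -> u (toC p) = v (toC p)) -> CI u = CI v.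
Proof. by move=> uv; congr Complex; apply: eq_Iw => p Dp; rewrite uv. Qed.

Lemma CID u v : cint u -> cint v -> CI (fun z => u z + v z) = CI u + CI v.
Proof.
move=> [ur ui] [vr vi]; congr Complex; rewrite -IwD//;
  by apply: eq_Iw => p _; rewrite raddfD.
Qed.

Lemma cintD u v : cint u -> cint v -> cint (fun z => u z + v z).
Proof.
move=> [ur ui] [vr vi]; split.
  have := intwD ur vr; congr (wintegrable _ _); apply/funext => p.
  by rewrite raddfD.
have := intwD ui vi; congr (wintegrable _ _); apply/funext => p.
by rewrite raddfD.
Qed.

Let ReM (a b : C) : complex.Re (a * b) =
  complex.Re a * complex.Re b + (- complex.Im a) * complex.Im b.
Proof. by case: a b => [x y] [s t] /=; rewrite mulNr. Qed.

Let ImM (a b : C) : complex.Im (a * b) =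
  complex.Re a * complex.Im b + complex.Im a * complex.Re b.
Proof. by case: a b => [x y] [s t]. Qed.

Lemma cintZ (k : C) u : cint u -> cint (fun z => k * u z).
Proof.
move=> [ur ui]; split.
  have := intwD (intwZ (complex.Re k) ur) (intwZ (- complex.Im k) ui).
  by congr (wintegrable _ _); apply/funext => p; rewrite ReM.
have := intwD (intwZ (complex.Re k) ui) (intwZ (complex.Im k) ur).
by congr (wintegrable _ _); apply/funext => p; rewrite ImM.
Qed.

Lemma CIZ (k : C) u : cint u -> CI (fun z => k * u z) = k * CI u.
Proof.
move=> [ur ui]; rewrite [RHS]complexE; apply/eqP; rewrite eq_complex /=; apply/andP; split.
  rewrite (@eq_Iw R alpha _ (fun p => complex.Re k * complex.Re (u (toC p)) + (- complex.Im k) * complex.Im (u (toC p)))).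
    rewrite IwD ?IwZ//; try exact: intwZ.
    by case: k => x y /=; apply/eqP; ring.
  by move=> p _; rewrite ReM.
rewrite (@eq_Iw R alpha _ (fun p => complex.Re k * complex.Im (u (toC p)) + complex.Im k * complex.Re (u (toC p)))).
  rewrite IwD ?IwZ//; try exact: intwZ.
  by case: k => x y /=; apply/eqP; ring.
by move=> p _; rewrite ImM.
Qed.

Definition nrm f : R := Iw (fun p => cmod (f (toC p)) ^+ 2).

Lemma bnormE f : bnorm alpha f = Num.sqrt (nrm f).
Proof. by []. Qed.

Lemma nrm_ge0 f : 0 <= nrm f.
Proof.
by apply: Rintegral_ge0 => p Dp; rewrite mulr_ge0 ?wdens_ge0// sqr_ge0.
Qed.

Lemma measurable_cmod2 f : analytic f ->
  measurable_fun D (fun p => cmod (f (toC p)) ^+ 2).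
Proof.
move=> af; rewrite (_ : (fun p => _) = fun p => complex.Re (f (toC p)) ^+ 2 + complex.Im (f (toC p)) ^+ 2).
  by apply: measurable_funD; apply: measurable_funX; [exact: measurable_Re|exact: measurable_Im].
by apply/funext => p; rewrite cmod_sq.
Qed.

Lemma L2aP f : L2a alpha f <-> analytic f /\ intw (fun p => cmod (f (toC p)) ^+ 2).
Proof.
have E : bnorm2 alpha f =
    (\int[mu]_(p in D) `|(cmod (f (toC p)) ^+ 2 * w p)%:E|)%E.
  apply: eq_integral => p _ /=.
  by rewrite ger0_norm// mulr_ge0 ?wdens_ge0// sqr_ge0.
split=> -[af h]; split => //.
  apply/integrableP; split; last by rewrite -E.
  by apply/measurable_EFinP; apply: measurable_mulw; exact: measurable_cmod2.
by move/integrableP: h => [_]; rewrite -E.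
Qed.

(** The integrand is dominated by M (|f|^2 + |g|^2). Taking [h] to be [psi] or 1 covers all
    integrals in the expansions of the quadratic form and of the squared norm. *)
Lemma cint_prod h M f g : analytic h -> (forall z, udisc z -> cmod (h z) <= M) ->
  L2a alpha f -> L2a alpha g -> cint (fun z => h z * f z * conjc (g z)).
Proof.
move=> ah hM /L2aP[af nf] /L2aP[ag ng].
pose v p := M * (cmod (f (toC p)) ^+ 2 + cmod (g (toC p)) ^+ 2).
have iv : intw v by apply: intwZ; exact: intwD.
have bnd p : D p -> cmod (h (toC p) * f (toC p) * conjc (g (toC p))) <= v p.
  move=> Dp; rewrite !cmodM (_ : cmod (conjc (g (toC p))) = cmod (g (toC p))); last first.
    by case: (g _) => x y; rewrite /cmod/= sqrrN.
  rewrite /v -mulrA; apply: ler_pM; rewrite ?mulr_ge0 ?cmod_ge0// ?hM//.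
  have := cmod_ge0 (f (toC p)); have := cmod_ge0 (g (toC p)).
  move: (cmod _) (cmod _) => s t; nra.
have ahf := analyticM ah af.
split; refine (intw_dom _ iv _).
- rewrite (_ : (fun p => _) = fun p => complex.Re (h (toC p) * f (toC p)) * complex.Re (g (toC p))
     + complex.Im (h (toC p) * f (toC p)) * complex.Im (g (toC p))); last first.
    by apply/funext => p; rewrite (ReM (_ * f _)); case: (g _) => x y /=; rewrite mulrNN.
  apply: measurable_funD; apply: measurable_funM;
    by [exact: measurable_Re|exact: measurable_Im|exact: (measurable_Re ahf)|exact: (measurable_Im ahf)].
- by move=> p Dp; apply: le_trans (Re_le_cmod _) (bnd p Dp).
- rewrite (_ : (fun p => _) = fun p => complex.Im (h (toC p) * f (toC p)) * complex.Re (g (toC p))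
     - complex.Re (h (toC p) * f (toC p)) * complex.Im (g (toC p))); last first.
    by apply/funext => p; rewrite (ImM (_ * f _)); case: (g _) => x y /=; rewrite mulrN addrC.
  apply: measurable_funB; apply: measurable_funM;
    by [exact: measurable_Re|exact: measurable_Im|exact: (measurable_Re ahf)|exact: (measurable_Im ahf)].
- by move=> p Dp; apply: le_trans (Im_le_cmod _) (bnd p Dp).
Qed.

Lemma L2aD f g : L2a alpha f -> L2a alpha g -> L2a alpha (fun z => f z + g z).
Proof.
move=> /L2aP[af nf] /L2aP[ag ng]; apply/L2aP; split; first exact: analyticD.
refine (intw_dom _ (intwZ 2 (intwD nf ng)) _).
  by apply: (@measurable_cmod2 (fun z => f z + g z)); exact: analyticD.
move=> p Dp; rewrite ger0_norm ?sqr_ge0//.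
have := cmodD (f (toC p)) (g (toC p)).
have := cmod_ge0 (f (toC p) + g (toC p)).
move: (cmod (f (toC p) + g (toC p))) (cmod (f (toC p))) (cmod (g (toC p))) => s t r s0 str.
have : s ^+ 2 <= (t + r) ^+ 2 by nra.
by have := sqr_ge0 (t - r); nra.
Qed.

Lemma L2aM h M f : analytic h -> (forall z, udisc z -> cmod (h z) <= M) ->
  L2a alpha f -> L2a alpha (fun z => h z * f z) /\
  nrm (fun z => h z * f z) <= M ^+ 2 * nrm f.
Proof.
move=> ah hM /L2aP[af nf].
have bnd p : D p -> cmod (h (toC p) * f (toC p)) ^+ 2 <= M ^+ 2 * cmod (f (toC p)) ^+ 2.
  move=> Dp; rewrite cmodM exprMn ler_wpM2r ?sqr_ge0// ler_pXn2r ?nnegrE ?cmod_ge0 ?hM//.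
  by apply: le_trans (hM _ Dp); exact: cmod_ge0.
have i : intw (fun p => cmod (h (toC p) * f (toC p)) ^+ 2).
  refine (intw_dom _ (intwZ (M ^+ 2) nf) _).
    by apply: (@measurable_cmod2 (fun z => h z * f z)); exact: analyticM.
  by move=> p Dp; rewrite ger0_norm ?sqr_ge0//; exact: bnd.
split; first by apply/L2aP; split; [exact: analyticM|exact: i].
by rewrite /nrm -IwZ//; apply: le_Iw; [exact: a1|exact: i|exact: intwZ|exact: bnd].
Qed.

Lemma L2aZ (k : C) f : L2a alpha f -> L2a alpha (fun z => k * f z).
Proof.
by move=> h; have [] := @L2aM (fun=> k) (cmod k) f (@analytic_cst R k) (fun _ _ => lexx _) h.
Qed.

Lemma nrmZ (k : C) f : L2a alpha f -> nrm (fun z => k * f z) = cmod k ^+ 2 * nrm f.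
Proof.
move=> /L2aP[af nf]; rewrite /nrm -IwZ//.
by apply: eq_Iw => p _; rewrite cmodM exprMn.
Qed.

Lemma mulCconj (z : C) : z * conjc z = (cmod z ^+ 2)%:C.
Proof.
rewrite cmod_sq; case: z => x y /=.
by rewrite /GRing.mul/=; congr Complex; ring.
Qed.

End Bergman_space.

(** * Convexity of the numerical range *)

Section Separation.
Local Open Scope complex_scope.
Variables (R : realType).
Local Notation C := (R[i])^o.
Local Notation analytic := (analytic_on (@udisc R)).

(** In coordinates with origin [c] and first axis towards a point [s0] of [S], a supremum of slopes
    gives a line through [c] with [S] on one side; convexity bounds the supremum by every point
    below the axis, and openness makes the inequality strict. *)
Lemma convex_sep (S : set C) (c : C) : S !=set0 -> open S -> convex_setC S -> ~ S c ->
  exists a b : R, forall s, S s ->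
    0 < a * (complex.Re s - complex.Re c) + b * (complex.Im s - complex.Im c).
Proof.
move=> [s0 Ss0] oS cS nSc.
have near z : S z -> exists2 r : R, 0 < r & forall z', cmod (z' - z) < r -> S z'.
  by move=> Sz; apply/nbhsC; move: oS; rewrite openE => /(_ _ Sz).
pose e1 := complex.Re s0 - complex.Re c; pose e2 := complex.Im s0 - complex.Im c.
pose N := e1 ^+ 2 + e2 ^+ 2.
have N0 : 0 < N.
  rewrite lt_neqAle addr_ge0 ?sqr_ge0// andbT eq_sym; apply/negP.
  rewrite paddr_eq0 ?sqr_ge0// !sqrf_eq0 !subr_eq0 => /andP[/eqP h1 /eqP h2].
  by apply: nSc; move: Ss0 h1 h2; case: (s0) (c) => [? ?] [? ?] /= ? <- <-.
(* [X] and [Y] are the coordinates of z - c along s0 - c and orthogonally to it, multiplied by |s0 -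
   c|. *)
pose X (z : C) := (complex.Re z - complex.Re c) * e1 + (complex.Im z - complex.Im c) * e2.
pose Y (z : C) := (complex.Im z - complex.Im c) * e1 - (complex.Re z - complex.Re c) * e2.
have Xs0 : X s0 = N by rewrite /X /N !expr2.
have Ys0 : Y s0 = 0 by rewrite /Y -/e1 -/e2; ring.
have XYc z t z' : X (t%:C * z + (1 - t)%:C * z') = t * X z + (1 - t) * X z' /\
    Y (t%:C * z + (1 - t)%:C * z') = t * Y z + (1 - t) * Y z'.
  by rewrite /X /Y; case: z z' => [? ?] [? ?] /=; split; ring.
have XY0 z : X z = 0 -> Y z = 0 -> z = c.
  rewrite /X /Y => hx hy.
  set u := complex.Re z - complex.Re c in hx hy; set v := complex.Im z - complex.Im c in hx hy.
  have : u * N = 0.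
    have -> : u * N = (u * e1 + v * e2) * e1 - (v * e1 - u * e2) * e2 by rewrite /N; ring.
    by rewrite hx hy !mul0r subr0.
  have : v * N = 0.
    have -> : v * N = (u * e1 + v * e2) * e2 + (v * e1 - u * e2) * e1 by rewrite /N; ring.
    by rewrite hx hy !mul0r addr0.
  move=> /eqP; rewrite mulf_eq0 (gt_eqF N0) orbF subr_eq0 => /eqP hv.
  move=> /eqP; rewrite mulf_eq0 (gt_eqF N0) orbF subr_eq0 => /eqP hu.
  by move: hu hv; case: (z) (c) => [? ?] [? ?] /= -> ->.
(* A point of [S] on the axis with X <= 0 would have [c] on its segment to [s0]. *)
have F1 z : S z -> Y z = 0 -> 0 < X z.
  move=> Sz Yz; rewrite ltNge; apply/negP => Xz.
  pose t := N / (N - X z).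
  have d0 : 0 < N - X z by lra.
  have t01 : 0 <= t <= 1.
    by rewrite divr_ge0 ?(ltW N0) ?(ltW d0)//= ler_pdivrMr// mul1r; lra.
  apply: nSc; rewrite -(XY0 (t%:C * z + (1 - t)%:C * s0)); first exact: cS.
    rewrite (XYc z t s0).1 Xs0 (_ : _ + _ = N - t * (N - X z)); last by ring.
    by rewrite /t divfK ?gt_eqF// subrr.
  by rewrite (XYc z t s0).2 Ys0 Yz !mulr0 addr0.
(* The segment from z1 to z2 crosses the axis inside [S], where X is positive by [F1]. *)
have F2 z1 z2 : S z1 -> S z2 -> 0 < Y z1 -> Y z2 < 0 ->
    0 < - Y z2 * X z1 + Y z1 * X z2.
  move=> S1 S2 Y1 Y2.
  have d0 : 0 < Y z1 - Y z2 by lra.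
  pose t := - Y z2 / (Y z1 - Y z2).
  have t01 : 0 <= t <= 1.
    by rewrite divr_ge0 ?(ltW d0)//= ?ler_pdivrMr//; lra.
  have td : t * (Y z1 - Y z2) = - Y z2 by rewrite /t divfK ?gt_eqF.
  have /F1 : S (t%:C * z1 + (1 - t)%:C * z2) by apply: cS.
  rewrite (XYc z1 t z2).1 (XYc z1 t z2).2 => h.
  have /h h2 : t * Y z1 + (1 - t) * Y z2 = 0 by move: td; lra.
  have : 0 < (t * X z1 + (1 - t) * X z2) * (Y z1 - Y z2) by exact: mulr_gt0.
  rewrite (_ : _ * _ = (t * (Y z1 - Y z2)) * X z1 + (Y z1 - Y z2 - t * (Y z1 - Y z2)) * X z2); last by ring.
  rewrite td; lra.
have shift z : S z -> exists2 k : R, 0 < k & forall a b : R, `|a| <= k -> `|b| <= k ->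
    exists2 z', S z' & X z' = X z + a * N /\ Y z' = Y z + b * N.
  move=> Sz; have [r r0 H] := near _ Sz.
  pose L := 1 + `|e1| + `|e2|.
  have L0 : 0 < L by rewrite /L; have := normr_ge0 e1; have := normr_ge0 e2; lra.
  exists (r / (8 * L)); first by rewrite divr_gt0// mulr_gt0.
  move=> a b ak bk.
  pose d : C := (a * e1 - b * e2) +i* (a * e2 + b * e1).
  exists (z + d).
    apply: H; rewrite addrAC subrr add0r.
    have aL (u v : R) : `|u| <= r / (8 * L) -> `|v| <= L -> `|u * v| <= r / 8.
      move=> h1 h2; rewrite normrM.
      apply: (@le_trans _ _ (r / (8 * L) * L)); first exact: ler_pM.
      by rewrite invfM mulrA divfK ?gt_eqF.
    have le1 : `|e1| <= L by rewrite /L; have := normr_ge0 e2; lra.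
    have le2 : `|e2| <= L by rewrite /L; have := normr_ge0 e1; lra.
    apply: le_lt_trans (cmod_le_ReIm _) _; rewrite /d/=.
    have h1 := aL _ _ ak le1; have h2 := aL _ _ bk le2.
    have h3 := aL _ _ ak le2; have h4 := aL _ _ bk le1.
    have h5 := ler_normB (a * e1) (b * e2).
    have h6 := ler_normD (a * e2) (b * e1).
    lra.
  by rewrite /X /Y /N /d; case: (z) => ? ? /=; split; ring.
(* The slopes B with X + B Y >= 0 at every point of [S] above the axis are the upper bounds of [E];
   by [F2], each point of [S] below the axis yields such a bound. *)
pose E : set R := [set - X z / Y z | z in [set z | S z /\ 0 < Y z]].
have [k0 k00 H0] := shift _ Ss0.
have [zp Szp [_ Yp]] := H0 0 k0 ltac:(by rewrite normr0 ltW) ltac:(by rewrite ger0_norm// ltW).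
have [zm Szm [_ Ym]] := H0 0 (- k0) ltac:(by rewrite normr0 ltW) ltac:(by rewrite normrN ger0_norm// ltW).
have Yp0 : 0 < Y zp by rewrite Yp Ys0 add0r mulr_gt0.
have Ym0 : Y zm < 0 by rewrite Ym Ys0 add0r mulNr oppr_lt0 mulr_gt0.
have ubE z : S z -> Y z < 0 -> ubound E (X z / - Y z).
  move=> Sz Yz _ [z1 [S1 Y1] <-].
  rewrite ler_pdivrMr// mulrAC ler_pdivlMr ?oppr_gt0//.
  have := F2 _ _ S1 Sz Y1 Yz; lra.
have hsE : has_sup E by split; [exists (- X zp / Y zp), zp|exists (X zm / - Y zm); exact: ubE].
pose B := sup E.
have ge0 z : S z -> 0 <= X z + B * Y z.
  move=> Sz; have [Yz|Yz|Yz] := ltgtP (Y z) 0.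
  - have : B <= X z / - Y z by apply: ge_sup; [case: hsE|exact: ubE].
    rewrite ler_pdivlMr ?oppr_gt0//; lra.
  - have : - X z / Y z <= B by apply: ub_le_sup; [case: hsE|exists z].
    rewrite ler_pdivrMr//; lra.
  - by rewrite Yz mulr0 addr0 ltW// F1.
exists (e1 - B * e2), (e2 + B * e1) => s Ss.
(* Moving s backwards along the first axis stays in [S] and lowers X by k N, so the weak inequality
   at the new point is a strict one at s. *)
have [k k0' H] := shift _ Ss.
have [z' Sz' [Xz' Yz']] := H (- k) 0 ltac:(by rewrite normrN ger0_norm// ltW) ltac:(by rewrite normr0 ltW).
have := ge0 _ Sz'; rewrite Xz' Yz' mul0r addr0.
have kN : 0 < k * N by exact: mulr_gt0.
by rewrite /X /Y; lra.
Qed.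

End Separation.

(** * The numerical range of a multiplication operator *)

Section Numerical_range.
Local Open Scope complex_scope.
Variables (R : realType) (alpha : R).
Hypothesis a1 : -1 < alpha.
Local Notation C := (R[i])^o.
Local Notation T := (measurableTypeR R * measurableTypeR R)%type.
Local Notation analytic := (analytic_on (@udisc R)).
Local Notation w := (@wdens R alpha : T -> R).
Local Notation D := (@udisc2 R : set T).
Local Notation mu := (@lebm R).
Local Notation intw := (wintegrable alpha).
Local Notation Iw := (wint alpha).
Local Notation CI := (CI alpha).
Local Notation nrm := (nrm alpha).
Variables (psi : C -> C) (M : R).
Hypothesis apsi : analytic psi.
Hypothesis psiM : forall z, udisc z -> cmod (psi z) <= M.
Local Notation W := (numrange alpha (wcomp psi (fun z => z))).
Implicit Types (f g : C -> C).

Lemma bnorm1 f : bnorm alpha f = 1 -> nrm f = 1.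
Proof.
by rewrite bnormE => h; rewrite -(sqr_sqrtr (nrm_ge0 a1 f)) h expr1n.
Qed.

Lemma cint_self f : L2a alpha f -> cint alpha (fun z => psi z * f z * conjc (f z)).
Proof. by move=> Lf; exact: (cint_prod a1 apsi psiM Lf Lf). Qed.

Lemma cint_mul1 f g : L2a alpha f -> L2a alpha g ->
  cint alpha (fun z => f z * conjc (g z)).
Proof.
move=> Lf Lg.
have h (z : C) : udisc z -> cmod (1 : C) <= 1.
  by move=> _; rewrite /cmod ComplexField.Normc.normc1.
have := @cint_prod _ _ a1 (fun=> 1) 1 f g (@analytic_cst R 1) h Lf Lg.
by congr cint; apply/funext => z; rewrite mul1r.
Qed.

Lemma CI_nrm f : CI (fun z => f z * conjc (f z)) = (nrm f)%:C.
Proof.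
rewrite (@eq_CI _ _ _ (fun z => (cmod (f z) ^+ 2)%:C)); last first.
  by move=> p _; rewrite mulCconj.
congr Complex; rewrite /CI /=.
by rewrite /wint; under eq_Rintegral do rewrite mul0r; rewrite /Rintegral integral0.
Qed.

(** Scaling f by 1 / sqrt(nrm f) divides the quadratic form by [nrm f]; test functions need not be
    normalised beforehand. *)
Lemma numrange_div f : L2a alpha f -> 0 < nrm f ->
  W (CI (fun z => psi z * f z * conjc (f z)) / (nrm f)%:C).
Proof.
move=> Lf n0.
pose k : C := ((Num.sqrt (nrm f))^-1)%:C.
have k2 : k * conjc k = (nrm f)%:C^-1.
  rewrite /k conjc_real -rmorphM -expr2 exprVn sqr_sqrtr ?nrm_ge0//.
  by rewrite fmorphV.
exists (fun z => k * f z); first split.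
- exact: L2aZ.
- rewrite bnormE nrmZ// /k cmod_real ger0_norm ?invr_ge0 ?sqrtr_ge0//.
  by rewrite exprVn sqr_sqrtr ?nrm_ge0// mulVf ?gt_eqF// sqrtr1.
rewrite [RHS]mulrC -k2 -CIZ; last exact: cint_self.
rewrite -[LHS]/(CI (fun z => psi z * (k * f z) * conjc (k * f z))).
by apply: eq_CI => p _; rewrite rmorphM; ring.
Qed.

(** If c = <psi f, f> were outside [S], the separating functional of psi - c, times |f|^2, would be
    nonnegative with integral zero, hence zero almost everywhere. Strict separation then leaves f =
    0 almost everywhere, against norm 1. *)
Lemma numrange_sub (S : set C) : S !=set0 -> open S -> convex_setC S ->
  (forall z, udisc z -> S (psi z)) -> W `<=` S.
Proof.
move=> S0 oS cS psiS c [f [Lf nf1] Ec].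
apply: contrapT => /(convex_sep S0 oS cS)[a [b sep]].
have N1 := bnorm1 nf1.
have /(L2aP a1)[af iN] := Lf.
have [ir ii] := cint_self Lf.
pose u (p : T) := a * complex.Re (psi (toC p) * f (toC p) * conjc (f (toC p)))
  + b * complex.Im (psi (toC p) * f (toC p) * conjc (f (toC p)))
  + (- (a * complex.Re c + b * complex.Im c)) * cmod (f (toC p)) ^+ 2.
have iu : intw u by apply: intwD; [apply: intwD; exact: intwZ|exact: intwZ].
have uE p : u p = (a * (complex.Re (psi (toC p)) - complex.Re c) +
    b * (complex.Im (psi (toC p)) - complex.Im c)) * cmod (f (toC p)) ^+ 2.
  rewrite /u -mulrA mulCconj; move: (cmod _ ^+ 2) => t.
  by case: (psi _) => x y /=; ring.
have Iu : Iw u = 0.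
  rewrite IwD ?IwD ?IwZ//; try exact: intwZ; last by apply: intwD; exact: intwZ.
  rewrite -[Iw (fun p => cmod _ ^+ 2)]/(nrm f) N1 mulr1.
  have -> : Iw (fun p => complex.Re (psi (toC p) * f (toC p) * conjc (f (toC p)))) = complex.Re c.
    by rewrite -Ec.
  have -> : Iw (fun p => complex.Im (psi (toC p) * f (toC p) * conjc (f (toC p)))) = complex.Im c.
    by rewrite -Ec.
  by rewrite subrr.
have u0 p : D p -> 0 <= u p.
  move=> Dp; rewrite uE; apply: mulr_ge0; last exact: sqr_ge0.
  by apply/ltW/sep/psiS.
have F := ae_filter_ringOfSetsType mu.
have : nrm f = 0.
  apply: ae0_Iw iN _; apply: (@filterS _ _ F _ _ _ (Iw_eq0 a1 iu u0 Iu)) => p h Dp.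
  have := h Dp; rewrite uE => /eqP; rewrite mulf_eq0 => /orP[/eqP h0|/eqP//].
  by have := sep _ (psiS _ Dp); rewrite h0 ltxx.
by rewrite N1 => /eqP; rewrite oner_eq0.
Qed.

(** For k = k1 + i k2 the imaginary part is k1 u + k2 v, with the [u] and [v] of the proof, so k is
    a unit vector orthogonal to (u, v). *)
Lemma unit_real_combination (P Q : C) : exists k : C, k * conjc k = 1 /\
  complex.Im (conjc k * P + k * Q) = 0.
Proof.
pose u := complex.Im P + complex.Im Q; pose v := complex.Re Q - complex.Re P.
have [uv0|uv0] := eqVneq (u ^+ 2 + v ^+ 2) 0.
  move: uv0 => /eqP; rewrite paddr_eq0 ?sqr_ge0// !sqrf_eq0 => /andP[/eqP u0 /eqP v0].
  exists 1; rewrite conjc1 mulr1 !mul1r; split => //.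
  by move: u0; rewrite /u; case: (P) (Q) => [? ?] [? ?].
have n0 : 0 < u ^+ 2 + v ^+ 2 by rewrite lt_neqAle eq_sym uv0 addr_ge0 ?sqr_ge0.
pose r := Num.sqrt (u ^+ 2 + v ^+ 2).
have r0 : r != 0 by rewrite gt_eqF// sqrtr_gt0.
have r2 : r ^+ 2 = u ^+ 2 + v ^+ 2 by rewrite sqr_sqrtr// ltW.
exists ((- v / r) +i* (u / r)); split.
  rewrite mulCconj cmod_sq/=; congr (_%:C).
  rewrite !expr_div_n sqrrN -mulrDl addrC -r2 divff//.
  by rewrite expf_neq0.
rewrite /u /v in r2 *; move: r0 => _; clear -R P Q r.
by move: r^-1 => ri; case: (P) (Q) => [p1 p2] [q1 q2] /=; ring.
Qed.

Lemma conjc_lin (x y : R) (k s t : C) :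
  conjc (x%:C * s + y%:C * k * t) = x%:C * conjc s + y%:C * conjc k * conjc t.
Proof. by rewrite rmorphD (rmorphM _ (y%:C * k)) !(rmorphM _ (_%:C)) /= !oppr0. Qed.

(** The classical two-vector argument. After the affine change taking a to 1 and b to 0, the
    quadratic form at x f + y k g is x^2 + x y be, where the phase k is chosen to make be real.
    Along y = 1 - x its quotient by the squared norm is then real and goes from 0 to 1, so it takes
    the value t. *)
Lemma numrange_convex (a b : C) (t : R) : W a -> W b -> 0 <= t <= 1 ->
  W (t%:C * a + (1 - t)%:C * b).
Proof.
move=> Wa Wb /andP[t0 t1].
have [ab|ab] := eqVneq a b.
  rewrite ab -mulrDl -rmorphD addrC subrK mul1r//.
move: Wa Wb => [f [Lf nf] Ea] [g [Lg ng] Eb].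
pose d := a - b; have d0 : d != 0 by rewrite subr_eq0.
pose P := CI (fun z => psi z * f z * conjc (g z)).
pose Q := CI (fun z => psi z * g z * conjc (f z)).
pose U := CI (fun z => f z * conjc (g z)).
pose V := CI (fun z => g z * conjc (f z)).
(* The two arguments are the cross terms of the form for the symbol (psi - b) / d. *)
have [k0 [k0k k0i]] := unit_real_combination ((P - b * U) / d) ((Q - b * V) / d).
pose h (x y : R) (k : C) z := x%:C * f z + (y%:C * k) * g z.
have Lh x y k : L2a alpha (h x y k) by apply: (L2aD a1); exact: (L2aZ a1).
have psih x y k : k * conjc k = 1 -> CI (fun z => psi z * h x y k z * conjc (h x y k z)) =
    (x ^+ 2)%:C * a + (x * y)%:C * (conjc k * P + k * Q) + (y ^+ 2)%:C * b.
  move=> kk.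
  have i1 := cint_prod a1 apsi psiM Lf Lf.
  have i2 := cint_prod a1 apsi psiM Lf Lg.
  have i3 := cint_prod a1 apsi psiM Lg Lf.
  have i4 := cint_prod a1 apsi psiM Lg Lg.
  rewrite (@eq_CI _ _ _ (fun z => (x ^+ 2)%:C * (psi z * f z * conjc (f z))
     + (x * y)%:C * (conjc k * (psi z * f z * conjc (g z)) + k * (psi z * g z * conjc (f z)))
     + (y ^+ 2)%:C * (psi z * g z * conjc (g z)))); last first.
    move=> p _; rewrite /h; move: (toC p) => z.
    rewrite -[(y ^+ 2)%:C]mulr1 -kk conjc_lin !rmorphM/=; ring.
  have i5 := cintD (cintZ (conjc k) i2) (cintZ k i3).
  have j1 := cintZ (x ^+ 2)%:C i1; have j2 := cintZ (x * y)%:C i5.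
  have j3 := cintZ (y ^+ 2)%:C i4.
  rewrite (CID (cintD j1 j2) j3) (CID j1 j2) (CIZ _ i1) (CIZ _ i5) (CIZ _ i4).
  rewrite (CID (cintZ (conjc k) i2) (cintZ k i3)) (CIZ _ i2) (CIZ _ i3).
  by rewrite -Ea -Eb.
have nh x y k : k * conjc k = 1 -> (nrm (h x y k))%:C =
    (x ^+ 2)%:C + (x * y)%:C * (conjc k * U + k * V) + (y ^+ 2)%:C.
  move=> kk; rewrite -CI_nrm.
  have i1 := cint_mul1 Lf Lf.
  have i2 := cint_mul1 Lf Lg.
  have i3 := cint_mul1 Lg Lf.
  have i4 := cint_mul1 Lg Lg.
  rewrite (@eq_CI _ _ _ (fun z => (x ^+ 2)%:C * (f z * conjc (f z))
     + (x * y)%:C * (conjc k * (f z * conjc (g z)) + k * (g z * conjc (f z)))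
     + (y ^+ 2)%:C * (g z * conjc (g z)))); last first.
    move=> p _; rewrite /h; move: (toC p) => z.
    rewrite -[(y ^+ 2)%:C]mulr1 -kk conjc_lin !rmorphM/=; ring.
  have i5 := cintD (cintZ (conjc k) i2) (cintZ k i3).
  have j1 := cintZ (x ^+ 2)%:C i1; have j2 := cintZ (x * y)%:C i5.
  have j3 := cintZ (y ^+ 2)%:C i4.
  rewrite (CID (cintD j1 j2) j3) (CID j1 j2) (CIZ _ i1) (CIZ _ i5) (CIZ _ i4).
  rewrite (CID (cintZ (conjc k) i2) (cintZ k i3)) (CIZ _ i2) (CIZ _ i3).
  by rewrite !CI_nrm !bnorm1// !mulr1.
(* Replacing k by -k keeps the imaginary part 0 and changes the sign of conj k U + k V. A
   nonnegative real part keeps the squared norm positive for 0 <= x <= 1. *)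
have [k [kk ki kU]] : exists k : C, [/\ k * conjc k = 1,
    complex.Im (conjc k * ((P - b * U) / d) + k * ((Q - b * V) / d)) = 0 &
    0 <= complex.Re (conjc k * U + k * V)].
  have [h0|h0] := leP 0 (complex.Re (conjc k0 * U + k0 * V)); first by exists k0.
  exists (- k0); rewrite rmorphN mulrNN; split => //.
    by rewrite !mulNr -opprD raddfN/= k0i oppr0.
  by rewrite !mulNr -opprD raddfN/= oppr_ge0 ltW.
pose be := complex.Re (conjc k * ((P - b * U) / d) + k * ((Q - b * V) / d)).
pose ga := complex.Re (conjc k * U + k * V).
have beE : conjc k * ((P - b * U) / d) + k * ((Q - b * V) / d) = be%:C.
  by rewrite [LHS]complexE ki mulr0 addr0.
(* This number is real because the squared norm of f + k g is. *)
have gaE : conjc k * U + k * V = ga%:C.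
  have := congr1 (@complex.Im R) (nh 1 1 k kk); rewrite /ga !expr1n mulr1 mul1r.
  by move: (conjc k * U + k * V) => [u v] /=; rewrite add0r addr0 => <-.
have nE x y : nrm (h x y k) = x ^+ 2 + x * y * ga + y ^+ 2.
  by apply: complexI; rewrite nh// gaE !rmorphD !rmorphM.
(* The equation for the value t, cleared of its denominator; the polynomial is -t at 0 and 1 - t at
   1. *)
have [x x01 xE] : exists2 x : R, 0 <= x <= 1 &
    x ^+ 2 + x * (1 - x) * be = t * (x ^+ 2 + x * (1 - x) * ga + (1 - x) ^+ 2).
  pose p : {poly R} := 'X ^+ 2 + 'X * (1 - 'X) * be%:P - t%:P * ('X ^+ 2 + 'X * (1 - 'X) * ga%:P + (1 - 'X) ^+ 2).
  have pE x : p.[x] = x ^+ 2 + x * (1 - x) * be - t * (x ^+ 2 + x * (1 - x) * ga + (1 - x) ^+ 2).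
    by rewrite /p !hornerE.
  have [|x x01 /rootP px] := @poly_ivt R p 0 1 ler01.
    by rewrite !pE; apply/andP; split; lra.
  by exists x => //; move: px; rewrite pE; lra.
have n0 : 0 < nrm (h x (1 - x) k).
  rewrite nE; case/andP: x01 => x0 x1.
  have : 0 <= x * (1 - x) * ga by rewrite mulr_ge0// mulr_ge0// subr_ge0.
  nra.
have := numrange_div (Lh x (1 - x) k) n0; rewrite psih//.
congr (W _).
have nC : (nrm (h x (1 - x) k))%:C != 0 by rewrite gt_eqF// ltcR.
apply/eqP; rewrite -(inj_eq (mulIf nC)) divfK//; apply/eqP.
have P' : conjc k * P + k * Q = d * be%:C + b * ga%:C.
  rewrite -beE -gaE.
  have E1 X Y : d * (conjc k * (X / d) + k * (Y / d)) = conjc k * X + k * Y.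
    by rewrite mulrDr ![d * (_ * (_ / d))]mulrCA !(mulrCA d) divff// !mulr1.
  rewrite E1; ring.
have e1 : (x ^+ 2)%:C + (x * (1 - x))%:C * be%:C = t%:C * (nrm (h x (1 - x) k))%:C.
  by rewrite nE -!rmorphM -rmorphD xE.
have e2 : (nrm (h x (1 - x) k))%:C =
    (x ^+ 2)%:C + (x * (1 - x))%:C * ga%:C + ((1 - x) ^+ 2)%:C.
  by rewrite nE -!rmorphM -!rmorphD.
transitivity (b * (nrm (h x (1 - x) k))%:C + d * (t%:C * (nrm (h x (1 - x) k))%:C)).
  by rewrite -e1 e2 P' /d; ring.
by rewrite /d (rmorphB _ 1 t) rmorph1; ring.
Qed.

End Numerical_range.

(** * Density of the numerical range *)

Section Dense_convex.
Local Open Scope complex_scope.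
Variables (R : realType) (alpha : R).
Hypothesis a1 : -1 < alpha.
Local Notation C := (R[i])^o.
Local Notation T := (measurableTypeR R * measurableTypeR R)%type.
Local Notation analytic := (analytic_on (@udisc R)).
Local Notation D := (@udisc2 R : set T).
Local Notation mu := (@lebm R).
Local Notation intw := (wintegrable alpha).
Local Notation Iw := (wint alpha).
Local Notation CI := (CI alpha).
Local Notation nrm := (nrm alpha).
Implicit Types (f g : C -> C).

(** Points of [V] close enough to the vertices of a triangle around s still span a triangle
    containing s. *)
Lemma dense_convex_sub (V S : set C) : convex_setC V -> open S ->
  (forall s e, S s -> 0 < e -> exists2 c, V c & cmod (c - s) <= e) -> S `<=` V.
Proof.
move=> cV oS dV s Ss.
have [r r0 rS] : exists2 r : R, 0 < r & forall z', cmod (z' - s) < r -> S z'.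
  by apply/nbhsC; move: oS; rewrite openE => /(_ _ Ss).
pose k := r / 4; have k0 : 0 < k by rewrite divr_gt0.
have approx (x y : R) : `|x| <= k -> `|y| <= k -> exists2 c, V c &
    `|complex.Re c - complex.Re s - x| <= k / 10 /\ `|complex.Im c - complex.Im s - y| <= k / 10.
  move=> xk yk; have /dV H : S (s + (x +i* y)).
    apply: rS; rewrite addrAC subrr add0r; apply: le_lt_trans (cmod_le_ReIm _) _ => /=.
    by apply: le_lt_trans (lerD xk yk) _; rewrite /k; lra.
  have [|c Vc cs] := H (k / 10); first by rewrite divr_gt0.
  exists c => //; split; apply: le_trans cs.
    by apply: le_trans (Re_le_cmod _); case: (s) (c) => ? ? [? ?] /=; rewrite opprD addrA.
  by apply: le_trans (Im_le_cmod _); case: (s) (c) => ? ? [? ?] /=; rewrite opprD addrA.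
have kk : `|k| <= k by rewrite ger0_norm// ltW.
have nk : `|- k| <= k by rewrite normrN.
have zk : `|0 : R| <= k by rewrite normr0 ltW.
have [a Va []] := approx _ _ nk nk; rewrite !ler_norml => /andP[? ?] /andP[? ?].
have [b Vb []] := approx _ _ kk nk; rewrite !ler_norml => /andP[? ?] /andP[? ?].
have [t Vt []] := approx _ _ zk kk; rewrite !ler_norml => /andP[? ?] /andP[? ?].
pose x1 := complex.Re a - complex.Re s; pose y1 := complex.Im a - complex.Im s.
pose x2 := complex.Re b - complex.Re s; pose y2 := complex.Im b - complex.Im s.
pose x3 := complex.Re t - complex.Re s; pose y3 := complex.Im t - complex.Im s.
(* Twice the signed areas of the triangles formed by s and two of the points: unnormalised
   barycentric coordinates of s. *)
pose A := x2 * y3 - y2 * x3; pose B := x3 * y1 - y3 * x1; pose G := x1 * y2 - y1 * x2.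
have A0 : 0 < A by rewrite /A /x2 /y2 /x3 /y3; nra.
have B0 : 0 < B by rewrite /B /x1 /y1 /x3 /y3; nra.
have G0 : 0 < G by rewrite /G /x2 /y2 /x1 /y1; nra.
have AB0 : 0 < A + B by lra.
have ABG0 : 0 < A + B + G by lra.
(* Convexity is stated for two points, so a and b are combined before the third point is added. *)
pose l := A / (A + B); pose m := (A + B) / (A + B + G).
have l01 : 0 <= l <= 1.
  by rewrite divr_ge0 ?(ltW A0) ?(ltW AB0)//= ler_pdivrMr// mul1r; lra.
have m01 : 0 <= m <= 1.
  by rewrite divr_ge0 ?(ltW AB0) ?(ltW ABG0)//= ler_pdivrMr// mul1r; lra.
have := cV _ _ _ (cV _ _ _ Va Vb l01) Vt m01.
congr V.
have mE : m * (A + B + G) = A + B by rewrite /m divfK ?gt_eqF.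
have lE : m * l * (A + B + G) = A.
  by rewrite mulrAC mE /l mulrC divfK ?gt_eqF.
have hx : A * x1 + B * x2 + G * x3 = 0 by rewrite /A /B /G; ring.
have hy : A * y1 + B * y2 + G * y3 = 0 by rewrite /A /B /G; ring.
clearbody l m A B G.
have X (u1 u2 u3 v : R) : A * (u1 - v) + B * (u2 - v) + G * (u3 - v) = 0 ->
   m * (l * u1 + (1 - l) * u2) + (1 - m) * u3 = v.
  move=> h; apply: (mulIf (lt0r_neq0 ABG0)) => /=.
  transitivity (m * l * (A + B + G) * u1 + (m * (A + B + G) - m * l * (A + B + G)) * u2
     + (A + B + G - m * (A + B + G)) * u3); first by ring.
  by rewrite lE mE; lra.
have := X _ _ _ _ hx; have := X _ _ _ _ hy.
by case: (a) (b) (t) (s) => [? ?] [? ?] [? ?] [? ?] /= <- <-; congr Complex; ring.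
Qed.

Lemma exp_ratio_small (a b A m : R) : 0 < a -> a < b -> 0 < m ->
  exists n : nat, a ^+ n * A <= b ^+ n * m.
Proof.
move=> a0 ab m0; have b0 : 0 < b by lra.
have q1 : `|a / b| < 1.
  by rewrite ger0_norm ?divr_ge0 ?(ltW a0) ?(ltW b0)// ltr_pdivrMr// mul1r.
have e0 : 0 < m / (1 + `|A|) by rewrite divr_gt0// ltr_wpDr.
have /cvgrPdist_lt/(_ _ e0)[n _ /(_ n (leqnn n))] := cvg_expr q1.
rewrite /= sub0r normrN expr_div_n => h; exists n.
have bn : 0 < b ^+ n by exact: exprn_gt0.
have an : 0 < a ^+ n by exact: exprn_gt0.
move: h; rewrite normrM [`|a ^+ n|]ger0_norm ?(ltW an)// normfV [`|b ^+ n|]ger0_norm ?(ltW bn)//.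
have A1 : 0 < 1 + `|A| by rewrite ltr_pwDl.
rewrite ltr_pdivrMr// mulrAC ltr_pdivlMr// => h.
have := ler_norm A; nra.
Qed.

(** The square of half-side r around p has area 4 r^2 and the indicator equals 1 on it, so the
    indicator cannot vanish almost everywhere on the disc. *)
Lemma Iw_box_gt0 (B : set T) (p : T) (r : R) : measurable B -> 0 < r ->
  (forall q, `|q.1 - p.1| < r -> `|q.2 - p.2| < r -> D q /\ B q) ->
  intw (\1_B : T -> R) /\ 0 < Iw (\1_B : T -> R).
Proof.
move=> mB r0 HB.
have iB : intw (\1_B : T -> R).
  apply: intw_dom (intw_cst a1 1) _; first exact: measurable_indic.
  by move=> q _; rewrite indicE; case: (q \in B); rewrite /= ?normr1 ?normr0 ?ler01.
split => //.
have ge0 : 0 <= Iw (\1_B : T -> R).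
  by apply: Rintegral_ge0 => q _; rewrite mulr_ge0 ?wdens_ge0// indicE ler0n.
rewrite lt_neqAle ge0 andbT eq_sym; apply/eqP => I0.
have ae0 := Iw_eq0 a1 iB (fun q _ => ltac:(by rewrite indicE ler0n)) I0.
pose Q : set T := `](p.1 - r), (p.1 + r)[%classic `*` `](p.2 - r), (p.2 + r)[%classic.
have mQ : measurable Q by apply: measurableX; exact: measurable_itv.
have : mu.-negligible Q.
  apply: negligibleS ae0 => q [/=]; rewrite !in_itv/= => /andP[h1 h2] /andP[h3 h4].
  have [||Dq Bq] := HB q; [by rewrite ltr_norml; lra|by rewrite ltr_norml; lra|].
  move=> /(_ Dq)/eqP; rewrite indicE (mem_set Bq) oner_eq0//.
move/(negligibleP _ mQ).1 => Q0.
have lE (x : R) : @lebesgue_measure R `]x - r, x + r[%classic = (r + r)%:E.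
  rewrite lebesgue_measure_itv/= lte_fin ifT; last lra.
  by rewrite -EFinB; congr EFin; ring.
have muQ : mu Q = ((r + r) * (r + r))%:E.
  transitivity (@lebesgue_measure R `](p.1 - r)%R, (p.1 + r)%R[%classic *
    @lebesgue_measure R `](p.2 - r)%R, (p.2 + r)%R[%classic)%E.
    by apply: product_measure1E; exact: measurable_itv.
  by rewrite !lE -EFinM.
have [] : ((r + r) * (r + r))%:E = 0%:E :> \bar R by rewrite -muQ; exact: Q0.
by move=> /eqP; rewrite mulf_eq0 orbb; lra.
Qed.

End Dense_convex.

(** * Peak functions at boundary points *)

Section Peaking.
Local Open Scope complex_scope.
Variables (R : realType) (alpha : R).
Hypothesis a1 : -1 < alpha.
Local Notation C := (R[i])^o.
Local Notation T := (measurableTypeR R * measurableTypeR R)%type.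
Local Notation analytic := (analytic_on (@udisc R)).
Local Notation D := (@udisc2 R : set T).
Local Notation mu := (@lebm R).
Local Notation intw := (wintegrable alpha).
Local Notation Iw := (wint alpha).
Local Notation CI := (CI alpha).
Local Notation nrm := (nrm alpha).
Implicit Types (f g : C -> C).

(** For |om| = 1 the base has value 1 at om and modulus below 1 at the other points of the closed
    disc. *)
Definition peak (om : C) (n : nat) (z : C) : C := ((1 + conjc om * z) / 2%:R) ^+ n.

Lemma analytic_peak om n : analytic (peak om n).
Proof.
apply: (@analyticX R (fun z => (1 + conjc om * z) / 2%:R)).
apply: (@analyticM R (fun z => 1 + conjc om * z) (fun=> 2%:R^-1)); last exact: analytic_cst.
apply: (@analyticD R (fun=> 1)); first exact: analytic_cst.
apply: (@analyticM R (fun=> conjc om)); [exact: analytic_cst|exact: analytic_id].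
Qed.

(** The parallelogram law for 1 and conj om z, with |1 - conj om z| = |z - om|. This form shows the
    dependence on the distance to om. *)
Lemma cmod_peak om n z : cmod om = 1 ->
  cmod (peak om n z) ^+ 2 = ((1 + cmod z ^+ 2) / 2 - cmod (z - om) ^+ 2 / 4) ^+ n.
Proof.
move=> om1; have om2 : cmod om ^+ 2 = 1 by rewrite om1 expr1n.
have cX (y : C) m : cmod (y ^+ m) = cmod y ^+ m.
  elim: m => [|m ih]; first by rewrite !expr0 /cmod ComplexField.Normc.normc1.
  by rewrite !exprS cmodM ih.
rewrite /peak cX exprAC; congr (_ ^+ n).
rewrite cmodM exprMn cmodV.
have -> : cmod (2%:R : C) = 2 by rewrite -(rmorph_nat (real_complex R)) cmod_real ger0_norm.
rewrite !cmod_sq; move: om2; rewrite cmod_sq; case: (om) z => [u v] [x y] /= h.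
transitivity ((1 + 2 * (u * x + v * y) + (u ^+ 2 + v ^+ 2) * (x ^+ 2 + y ^+ 2)) / 4); first by field.
rewrite (_ : (x - u) ^+ 2 + (y - v) ^+ 2 = x ^+ 2 + y ^+ 2 - 2 * (u * x + v * y) + (u ^+ 2 + v ^+ 2)); last by ring.
by rewrite h; field.
Qed.

(** The factor 2 comes from estimating the real and imaginary parts separately. *)
Lemma cmod_CI_le v u : cint alpha v -> intw u ->
  (forall p, D p -> cmod (v (toC p)) <= u p) ->
  cmod (CI v) <= 2 * Iw u.
Proof.
move=> [vr vi] iu vu.
have key (x : T -> R) : intw x -> (forall p, D p -> `|x p| <= u p) -> `|Iw x| <= Iw u.
  move=> ix xu; rewrite ler_norml; apply/andP; split.
    rewrite -mulN1r -IwZ//; apply: (le_Iw a1) => //; first exact: intwZ.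
    by move=> p /xu; rewrite ler_norml mulN1r => /andP[].
  by apply: (le_Iw a1) => // p /xu; rewrite ler_norml => /andP[].
apply: le_trans (cmod_le_ReIm _) _; rewrite mulr_natl mulr2n; apply: lerD.
  by apply: key => // p Dp; apply: le_trans (Re_le_cmod _) (vu p Dp).
by apply: key => // p Dp; apply: le_trans (Im_le_cmod _) (vu p Dp).
Qed.

(** At distance at least d from om, |f|^2 <= a^n; on a smaller neighbourhood, of positive measure,
    |f|^2 >= b^n with b > a. For a suitable n the far part of the error is at most e times the total
    mass, as is the near part; the factor 2 of [cmod_CI_le] makes 4 e. *)
Lemma numrange_peak (psi : C -> C) (M : R) (om s : C) (d e : R) :
  analytic psi -> (forall z, udisc z -> cmod (psi z) <= M) ->
  cmod om = 1 -> 0 < d -> d <= 1 -> 0 < e ->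
  (forall z, udisc z -> cmod (z - om) < d -> cmod (psi z - s) <= e) ->
  exists2 c, numrange alpha (wcomp psi (fun z => z)) c & cmod (c - s) <= 4 * e.
Proof.
move=> apsi psiM om1 d0 d1 e0 near.
(* The base P of |f|^2 is at most a at distance at least d from om, and at least 1 - 2 d' = b within
   distance d'. *)
pose a := 1 - d ^+ 2 / 4; pose b := 1 - d ^+ 2 / 8; pose d' := d ^+ 2 / 16.
have d2 : 0 < d ^+ 2 by rewrite exprn_gt0.
have d21 : d ^+ 2 <= 1 by rewrite expr_le1// ltW.
have a0 : 0 < a by rewrite /a; lra.
have ab : a < b by rewrite /a /b; lra.
have d'0 : 0 < d' by rewrite /d'; lra.
have d'1 : d' <= 1 / 16 by rewrite /d'; lra.
pose P z := (1 + cmod z ^+ 2) / 2 - cmod (z - om) ^+ 2 / 4.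
have P0 z : 0 <= P z by rewrite -[P z]expr1 -cmod_peak// sqr_ge0.
have Pa z : udisc z -> d <= cmod (z - om) -> P z <= a.
  rewrite /udisc/= /P /a => z1 dz.
  have : cmod z ^+ 2 <= 1 by rewrite expr_le1 ?cmod_ge0// ltW.
  have : d ^+ 2 <= cmod (z - om) ^+ 2 by rewrite ler_pXn2r ?nnegrE ?cmod_ge0// ltW.
  lra.
have Pb z : cmod (z - om) < d' -> b <= P z.
  rewrite /P => zd.
  have zl : 1 - d' <= cmod z.
    have := cmodD z (om - z); rewrite addrC subrK om1 -(cmodN (om - z)) opprB; lra.
  have : (1 - d') ^+ 2 <= cmod z ^+ 2 by rewrite ler_pXn2r ?nnegrE ?cmod_ge0//; lra.
  have := cmod_ge0 (z - om); move: (cmod (z - om)) zd => t td t0.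
  have : t ^+ 2 <= d' ^+ 2 by rewrite ler_pXn2r ?nnegrE ?(ltW d'0)// ltW.
  have -> : b = 1 - 2 * d' by rewrite /b /d'; field.
  nra.
pose B : set T := [set p | D p /\ cmod (toC p - om) < d'].
pose r := d' / 8; have r0 : 0 < r by rewrite divr_gt0.
have oB : box_open B.
  move=> p [Dp pd]; have [r1 r10 H1] := @box_open_udisc2 R _ Dp.
  have r20 : 0 < (d' - cmod (toC p - om)) / 2 by rewrite divr_gt0// subr_gt0.
  exists (Num.min r1 ((d' - cmod (toC p - om)) / 2)); first by rewrite lt_min r10.
  move=> q; rewrite !lt_min => /andP[q1 q2] /andP[q3 q4]; split; first exact: H1.
  have := cmodD (toC q - toC p) (toC p - om); rewrite addrA subrK.
  have := cmod_le_ReIm (toC q - toC p); rewrite /=; lra.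
(* The point of the radius to om at distance d' / 2 from om; a square of half-side d' / 8 around it
   lies in [B]. *)
pose p0 : T := ((1 - d' / 2) * complex.Re om, (1 - d' / 2) * complex.Im om).
have p0E : toC p0 = (1 - d' / 2)%:C * om.
  by rewrite /toC /p0; case: (om) => u v /=; congr Complex; ring.
have p01 : cmod (toC p0) = 1 - d' / 2.
  by rewrite p0E cmodM om1 mulr1 cmod_real ger0_norm//; lra.
have p02 : cmod (toC p0 - om) = d' / 2.
  rewrite p0E -[X in _ - X]mul1r -mulrBl -(rmorph1 (real_complex R)) -rmorphB cmodM om1 mulr1.
  by rewrite cmod_real distrC ger0_norm; lra.
have HB q : `|q.1 - p0.1| < r -> `|q.2 - p0.2| < r -> D q /\ B q.
  move=> q1 q2.
  have qp : cmod (toC q - toC p0) <= d' / 4.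
    have h : cmod (toC q - toC p0) <= `|q.1 - p0.1| + `|q.2 - p0.2| := cmod_le_ReIm (toC q - toC p0).
    by apply: le_trans h _; apply: le_trans (lerD (ltW q1) (ltW q2)) _; rewrite /r; lra.
  have Dq : D q.
    change (cmod (toC q) < 1); have := cmodD (toC q - toC p0) (toC p0).
    by rewrite subrK p01; lra.
  split => //; split => //.
  by have := cmodD (toC q - toC p0) (toC p0 - om); rewrite addrA subrK p02; lra.
have mB : measurable B by exact: box_open_measurable.
have [iB m0] := Iw_box_gt0 a1 mB r0 HB.
pose K := M + cmod s.
have [n hn] := exp_ratio_small (K * Iw (fun=> 1)) a0 ab (mulr_gt0 e0 m0).
pose f := peak om n.
have f2 z : cmod (f z) ^+ 2 = P z ^+ n by rewrite cmod_peak.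
have P1 z : udisc z -> P z <= 1.
  rewrite /udisc/= => z1.
  have : cmod z ^+ 2 <= 1 by rewrite expr_le1 ?cmod_ge0// ltW.
  by have := sqr_ge0 (cmod (z - om)); rewrite /P; lra.
have af : analytic f := @analytic_peak om n.
have i1 := intw_cst a1 1.
have iF : intw (fun p => cmod (f (toC p)) ^+ 2).
  refine (intw_dom (measurable_cmod2 af) i1 _) => p Dp.
  by rewrite ger0_norm ?sqr_ge0// f2 exprn_ile1// P1.
have Lf : L2a alpha f by apply/(L2aP a1); split; [exact: af|exact: iF].
have b0 : 0 < b by lra.
have Nb : b ^+ n * Iw (\1_B : T -> R) <= nrm f.
  rewrite -IwZ//; apply: (le_Iw a1); [exact: intwZ|exact: iF|].
  move=> p Dp; rewrite indicE f2; case: (boolP (p \in B)) => [/set_mem[_ pd]|_].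
    by rewrite mulr1; apply: lerXn2r; rewrite ?nnegrE ?(ltW b0) ?P0//; exact: Pb.
  by rewrite mulr0 exprn_ge0.
have N0 : 0 < nrm f by apply: lt_le_trans Nb; rewrite mulr_gt0// exprn_gt0.
exists (CI (fun z => psi z * f z * conjc (f z)) / (nrm f)%:C).
  exact: (numrange_div a1 apsi psiM Lf N0).
have nC : (nrm f)%:C != 0 by rewrite gt_eqF// ltcR.
have c1 := cint_prod a1 apsi psiM Lf Lf.
have c2 := cint_mul1 a1 Lf Lf.
have -> : CI (fun z => psi z * f z * conjc (f z)) / (nrm f)%:C - s =
    CI (fun z => psi z * f z * conjc (f z) + (- s) * (f z * conjc (f z))) / (nrm f)%:C.
  rewrite (CID c1 (cintZ (- s) c2)) (CIZ _ c2) CI_nrm mulrDl.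
  by rewrite [X in _ = _ + X]mulfK.
rewrite cmodM cmodV cmod_real ger0_norm ?(ltW N0)// ler_pdivrMr//.
pose u (p : T) := e * cmod (f (toC p)) ^+ 2 + (a ^+ n * K) * 1.
have iu : intw u by apply: intwD; exact: intwZ.
apply: le_trans (cmod_CI_le (cintD c1 (cintZ (- s) c2)) iu _) _.
  move=> p Dp.
  have -> : psi (toC p) * f (toC p) * conjc (f (toC p)) + - s * (f (toC p) * conjc (f (toC p)))
     = (psi (toC p) - s) * (f (toC p) * conjc (f (toC p))) by ring.
  rewrite mulCconj cmodM cmod_real ger0_norm ?sqr_ge0// /u mulr1.
  have K1 : cmod (psi (toC p) - s) <= K.
    by apply: le_trans (cmodD _ _) _; rewrite cmodN lerD2r psiM.
  have K0 : 0 <= K by apply: le_trans K1; exact: cmod_ge0.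
  have F0 := sqr_ge0 (cmod (f (toC p))).
  have [pd|pd] := ltP (cmod (toC p - om)) d.
    apply: (@le_trans _ _ (e * cmod (f (toC p)) ^+ 2)); first by rewrite ler_wpM2r// near.
    by rewrite lerDl mulr_ge0// exprn_ge0// ltW.
  apply: (@le_trans _ _ (a ^+ n * K)); last by rewrite lerDr mulr_ge0// ltW.
  rewrite mulrC; apply: ler_pM => //; first exact: cmod_ge0.
  by rewrite f2; apply: lerXn2r; rewrite ?nnegrE ?(ltW a0) ?P0//; exact: Pa.
rewrite (IwD (intwZ e iF) (intwZ (a ^+ n * K) i1)) (IwZ _ iF) (IwZ _ i1).
rewrite -[Iw (fun p => cmod _ ^+ 2)]/(nrm f).
have : e * (b ^+ n * Iw (\1_B : T -> R)) <= e * nrm f by rewrite ler_wpM2l// ltW.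
lra.
Qed.

End Peaking.

(** * Construction of the symbol *)

Section Kernel_series.
Local Open Scope complex_scope.
Variables (R : realType).
Local Notation C := (R[i])^o.

Lemma half_pow (n : nat) : (2^-1 : R) ^+ n.+1 = 2^-1 ^+ n / 2.
Proof. by rewrite exprS mulrC. Qed.

(** The passage to the limit that removes truncation errors from the estimates on series. *)
Lemma le_half_pow (x y A : R) : (forall n, x <= y + A * 2^-1 ^+ n) -> x <= y.
Proof.
move=> h; rewrite leNgt; apply/negP => yx.
have q1 : `|2^-1 : R| < 1 by rewrite ger0_norm//; lra.
have e0 : 0 < (x - y) / (1 + `|A|) by rewrite divr_gt0 ?subr_gt0// ltr_pwDl.
have /cvgrPdist_lt/(_ _ e0)[n _ /(_ n (leqnn n))] := cvg_expr q1.
have A1 : 0 < 1 + `|A| by rewrite ltr_pwDl.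
rewrite /= sub0r normrN ger0_norm ?exprn_ge0// ltr_pdivlMr//.
have p0 : 0 <= (2^-1 : R) ^+ n by rewrite exprn_ge0.
have : 0 <= 2^-1 ^+ n * (`|A| - A) by rewrite mulr_ge0// subr_ge0 ler_norm.
move: (h n) p0; move: (2^-1 ^+ n) => p; lra.
Qed.

Lemma sum_half_pow n : \sum_(j < n) (2^-1 : R) ^+ j = 2 - 2 * 2^-1 ^+ n.
Proof.
elim: n => [|n ih]; first by rewrite big_ord0 expr0; ring.
by rewrite big_ord_recr/= ih half_pow; field.
Qed.

(** The intervals [s n - E n, s n + E n] are nested, because the n-th term is at most E n / 2 = E n
    - E (n+1); the sum is the supremum of their left ends. *)
Lemma real_geo_sum (a : nat -> R) (B : R) : (forall j, `|a j| <= B * 2^-1 ^+ j) ->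
  exists l, forall n, `|\sum_(j < n) a j - l| <= 2 * B * 2^-1 ^+ n.
Proof.
move=> aB.
pose s n := \sum_(j < n) a j.
pose E n := 2 * B * (2^-1 : R) ^+ n.
have B0 : 0 <= B by have := le_trans (normr_ge0 _) (aB 0%N); rewrite expr0 mulr1.
have E0 n : 0 <= E n by rewrite /E mulr_ge0 ?exprn_ge0// mulr_ge0.
have st n k : `|s (n + k)%N - s n| <= E n - E (n + k)%N.
  elim: k => [|k ih]; first by rewrite addn0 !subrr normr0.
  have -> : s (n + k.+1)%N = s (n + k)%N + a (n + k)%N by rewrite /s addnS big_ord_recr.
  have := ler_normD (s (n + k)%N - s n) (a (n + k)%N); rewrite addrAC.
  have aE : `|a (n + k)%N| <= E (n + k)%N / 2.
    by apply: le_trans (aB _) _; rewrite /E le_eqVlt; apply/orP; left; apply/eqP; field.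
  rewrite (_ : E (n + k.+1)%N = E (n + k)%N / 2); last by rewrite /E addnS half_pow mulrA.
  lra.
have vs n m : s n - E n <= s m + E m.
  have [nm|/ltnW mn] := leqP n m.
    have := st n (m - n)%N; rewrite subnKC// ler_norml => /andP[].
    have := E0 m; lra.
  have := st m (n - m)%N; rewrite subnKC// ler_norml => /andP[].
  have := E0 n; lra.
pose V : set R := [set s n - E n | n in [set: nat]].
have hs : has_sup V.
  by split; [exists (s 0%N - E 0%N), 0%N|exists (s 0%N + E 0%N) => _ [n _ <-]].
exists (sup V) => n; rewrite -/(s n) -/(E n) ler_norml; apply/andP; split.
  have : sup V <= s n + E n by apply: ge_sup; [case: hs|move=> _ [m _ <-]].
  lra.
have : s n - E n <= sup V by apply: ub_le_sup; [case: hs|exists n].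
lra.
Qed.

Lemma geo_sum (a : nat -> C) (B : R) : (forall j, cmod (a j) <= B * 2^-1 ^+ j) ->
  exists l : C, forall n, cmod (\sum_(j < n) a j - l) <= 4 * B * 2^-1 ^+ n.
Proof.
move=> aB.
have [x hx] := real_geo_sum (fun j => le_trans (Re_le_cmod (a j)) (aB j)).
have [y hy] := real_geo_sum (fun j => le_trans (Im_le_cmod (a j)) (aB j)).
exists (x +i* y) => n; apply: le_trans (cmod_le_ReIm _) _.
rewrite !raddfB/= !raddf_sum/=; have := hx n; have := hy n; lra.
Qed.

Definition kern (j : nat) (w : C) : C := (1 + (2 ^+ j)%:C * w)^-1.

(** |1 + t w|^2 = 1 + 2 t Re w + t^2 |w|^2, and the middle term is positive in the half-plane. *)
Lemma kern_den_ge (j : nat) (w : C) : 0 < complex.Re w ->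
  1 <= cmod (1 + (2 ^+ j)%:C * w) /\ 2 ^+ j * cmod w <= cmod (1 + (2 ^+ j)%:C * w).
Proof.
move=> w0; have t0 : 0 < (2 : R) ^+ j by exact: exprn_gt0.
move: (2 ^+ j) t0 => t t0.
have E : cmod (1 + t%:C * w) ^+ 2 = 1 + 2 * t * complex.Re w + (t * cmod w) ^+ 2.
  by rewrite exprMn !cmod_sq; case: (w) => x y /=; ring.
have tw : 0 < t * complex.Re w by exact: mulr_gt0.
have c0 := cmod_ge0 w; have tc : 0 <= t * cmod w by rewrite mulr_ge0// ltW.
split; rewrite -(ler_pXn2r (ltn0Sn 1)) ?nnegrE ?cmod_ge0// E ?expr1n.
  by have := sqr_ge0 (t * cmod w); lra.
lra.
Qed.

Lemma kern_neq0 j (w : C) : 0 < complex.Re w -> 1 + (2 ^+ j)%:C * w != 0.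
Proof.
move=> /(kern_den_ge j)[h _]; apply/eqP => e0; move: h.
by rewrite e0 /cmod ComplexField.Normc.normc0; lra.
Qed.

Lemma cmod_gt0 (w : C) : 0 < complex.Re w -> 0 < cmod w.
Proof. by move=> w0; apply: lt_le_trans (Re_le_cmod _); rewrite gtr0_norm. Qed.

Lemma kern_le1 j (w : C) : 0 < complex.Re w -> cmod (kern j w) <= 1.
Proof.
by move=> w0; rewrite cmodV invf_le1; have [] := kern_den_ge j w0; lra.
Qed.

Lemma kern_le j (w : C) : 0 < complex.Re w -> cmod (kern j w) <= (cmod w)^-1 * 2^-1 ^+ j.
Proof.
move=> w0; have c0 := cmod_gt0 w0; have t0 : 0 < (2 : R) ^+ j by exact: exprn_gt0.
have [h1 h2] := kern_den_ge j w0; have d0 : 0 < cmod (1 + (2 ^+ j)%:C * w) by lra.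
by rewrite cmodV exprVn -invfM lef_pV2 ?posrE ?mulr_gt0// mulrC.
Qed.

Lemma kern_sub1_le j (w : C) : 0 < complex.Re w -> cmod (kern j w - 1) <= 2 ^+ j * cmod w.
Proof.
move=> w0; have t0 : 0 < (2 : R) ^+ j by exact: exprn_gt0.
have -> : kern j w - 1 = - ((2 ^+ j)%:C * w) * kern j w.
  apply: (mulfI (kern_neq0 j w0)); rewrite mulrBr mulrCA /kern mulfV ?kern_neq0// !mulr1.
  by rewrite opprD addrA subrr sub0r.
rewrite cmodM cmodN cmodM cmod_real gtr0_norm//.
by apply: ler_piMr; [rewrite mulr_ge0 ?cmod_ge0// ltW|exact: kern_le1].
Qed.

(** The derivative of kern j (w - h) in h at 0 is 2^j (kern j w)^2, and the remainder is exactly h^2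
    4^j (kern j w)^2 kern j (w - h). Three kernels of order 2^-j against 4^j leave 2^-j, which is
    summable. *)
Lemma kern_quad j (w h : C) : 0 < complex.Re w -> 0 < complex.Re (w - h) ->
  cmod w / 2 <= cmod (w - h) ->
  cmod (kern j (w - h) - kern j w - h * ((2 ^+ j)%:C * kern j w ^+ 2)) <=
    2 / cmod w ^+ 3 * 2^-1 ^+ j * cmod h ^+ 2.
Proof.
move=> w0 wh0 wh.
have t0 : 0 < (2 : R) ^+ j by exact: exprn_gt0.
have -> : kern j (w - h) - kern j w - h * ((2 ^+ j)%:C * kern j w ^+ 2) =
   h ^+ 2 * ((2 ^+ j)%:C ^+ 2 * (kern j w ^+ 2 * kern j (w - h))).
  rewrite /kern; have := kern_neq0 j w0; have := kern_neq0 j wh0.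
  move: (2 ^+ j)%:C => t n1 n2.
  by field; rewrite n1 n2.
have cX (y : C) : cmod (y ^+ 2) = cmod y ^+ 2 by rewrite !expr2 cmodM.
rewrite (cmodM (h ^+ 2)) (cmodM ((2 ^+ j)%:C ^+ 2)) (cmodM (kern j w ^+ 2)) !cX.
rewrite cmod_real gtr0_norm// mulrC ler_wpM2r ?sqr_ge0//.
have c0 := cmod_gt0 w0; have c1 := cmod_gt0 wh0.
have k1 := kern_le j w0; have k2 := kern_le j wh0.
have ih : (cmod (w - h))^-1 <= 2 / cmod w.
  by rewrite -[leRHS]invrK lef_pV2 ?posrE ?invr_gt0 ?divr_gt0// invf_div.
have k3 : cmod (kern j (w - h)) <= 2 / cmod w * 2^-1 ^+ j.
  by apply: le_trans k2 _; rewrite ler_wpM2r// exprn_ge0.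
apply: (@le_trans _ _ ((2 ^+ j) ^+ 2 * (((cmod w)^-1 * 2^-1 ^+ j) ^+ 2 * (2 / cmod w * 2^-1 ^+ j)))).
  rewrite ler_wpM2l ?sqr_ge0//; apply: ler_pM => //; rewrite ?sqr_ge0 ?cmod_ge0//.
  by rewrite ler_pXn2r ?nnegrE ?cmod_ge0// mulr_ge0 ?exprn_ge0// invr_ge0 ltW.
rewrite exprVn le_eqVlt; apply/orP; left; apply/eqP.
move: (2 ^+ j) t0 => t t0; field; by rewrite !gt_eqF.
Qed.

(** Bounded coefficients suffice because the kernels are O(2^-j) at each z, and the remainders of
    [kern_quad] sum to a multiple of |h|^2. The geometric rate is kept in the conclusion so that
    bounds on partial sums pass to [f]. *)
Lemma kern_series (D : nat -> C) (L : R) : (forall j, cmod (D j) <= L) ->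
  exists f : C -> C, (forall z, @udisc R z -> derivable f z 1) /\
    (forall z, @udisc R z -> exists A : R, forall n,
      cmod (\sum_(j < n) D j * kern j (1 - z) - f z) <= A * 2^-1 ^+ n).
Proof.
move=> DL.
have L0 : 0 <= L by apply: le_trans (DL 0%N); exact: cmod_ge0.
have Rw (z : C) : udisc z -> 0 < complex.Re (1 - z).
  move=> z1; rewrite raddfB/= subr_gt0; apply: le_lt_trans z1.
  by apply: le_trans (Re_le_cmod _); exact: ler_norm.
(* The condition on z sits under the existential, so that [choice] yields a function on the whole
   plane. *)
have ex z : exists l : C, udisc z -> exists A : R, forall n,
      cmod (\sum_(j < n) D j * kern j (1 - z) - l) <= A * 2^-1 ^+ n.
  have [Dz|nDz] := pselect (@udisc R z); last by exists 0.
  have [|l hl] := @geo_sum (fun j => D j * kern j (1 - z)) (L * (cmod (1 - z))^-1).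
    move=> j; rewrite cmodM -mulrA; apply: ler_pM; rewrite ?cmod_ge0//.
    exact/kern_le/Rw.
  by exists l => _; eexists; exact: hl.
have [f fP] := choice ex.
exists f; split => // z Dz.
have w0 := Rw z Dz; set w := 1 - z in w0; have c0 := cmod_gt0 w0.
have [|d hd] := @geo_sum (fun j => D j * ((2 ^+ j)%:C * kern j w ^+ 2)) (L * (cmod w)^-1 ^+ 2).
  move=> j; have t0 : 0 < (2 : R) ^+ j by exact: exprn_gt0.
  rewrite cmodM -mulrA; apply: ler_pM; rewrite ?cmod_ge0// cmodM cmod_real gtr0_norm// expr2 cmodM.
  have k := kern_le j w0.
  apply: (@le_trans _ _ (2 ^+ j * (((cmod w)^-1 * 2^-1 ^+ j) * ((cmod w)^-1 * 2^-1 ^+ j)))).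
    by rewrite ler_wpM2l ?(ltW t0)//; apply: ler_pM; rewrite ?cmod_ge0.
  rewrite exprVn le_eqVlt; apply/orP; left; apply/eqP.
  by move: (2 ^+ j) t0 => t t0; field; rewrite !gt_eqF.
(* Then z + h stays in the disc and |w - h| >= |w| / 2, as [kern_quad] requires. *)
pose r := Num.min (1 - cmod z) (cmod w / 2).
have r0 : 0 < r by rewrite lt_min subr_gt0 divr_gt0// andbT.
apply: (@derivable_quad R f z d (4 * L / cmod w ^+ 3) r r0) => h.
rewrite lt_min => /andP[h1 h2].
have Dzh : @udisc R (z + h).
  by apply: le_lt_trans (cmodD _ _) _; lra.
have whE : 1 - (z + h) = w - h by rewrite /w opprD addrA.
have wh0 : 0 < complex.Re (w - h) by rewrite -whE; exact: Rw.
have wh : cmod w / 2 <= cmod (w - h) by have := cmodD (w - h) h; rewrite subrK; lra.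
have [A1 H1] := fP _ Dz; have [A2 H2] := fP _ Dzh.
(* The three truncation errors, for f z, f (z + h) and d, vanish as n grows. *)
apply: (@le_half_pow _ _ (A1 + A2 + (4 * (L * (cmod w)^-1 ^+ 2)) * cmod h)) => n.
have H1n := H1 n; have H2n := H2 n; have hdn := hd n.
rewrite whE in H2n; rewrite -/w in H1n.
set s1 := \sum_(j < n) _ in H1n; set s2 := \sum_(j < n) _ in H2n; set s3 := \sum_(j < n) _ in hdn.
have main : cmod (s2 - s1 - h * s3) <= 4 * L / cmod w ^+ 3 * cmod h ^+ 2.
  rewrite /s1 /s2 /s3 mulr_sumr -!sumrB.
  have term (j : 'I_n) : cmod (D j * kern j (w - h) - D j * kern j w - h * (D j * ((2 ^+ j)%:C * kern j w ^+ 2)))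
      <= 2 * L / cmod w ^+ 3 * cmod h ^+ 2 * 2^-1 ^+ j.
    rewrite (_ : _ - _ = D j * (kern j (w - h) - kern j w - h * ((2 ^+ j)%:C * kern j w ^+ 2))); last by ring.
    rewrite cmodM.
    apply: le_trans (ler_pM (cmod_ge0 _) (cmod_ge0 _) (DL j) (kern_quad j w0 wh0 wh)) _.
    by rewrite le_eqVlt; apply/orP; left; apply/eqP; ring.
  apply: (@le_trans _ _ (\sum_(j < n) (2 * L / cmod w ^+ 3 * cmod h ^+ 2 * 2^-1 ^+ j))).
    elim/big_ind2 : _ => [|x a y b xa yb|j _]; last exact: term.
      by rewrite /cmod ComplexField.Normc.normc0.
    by apply: le_trans (cmodD _ _) _; exact: lerD.
  rewrite -mulr_sumr sum_half_pow.
  have p0 : 0 <= (2^-1 : R) ^+ n by rewrite exprn_ge0.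
  have : 0 <= L / cmod w ^+ 3 * cmod h ^+ 2.
    by rewrite mulr_ge0 ?sqr_ge0// divr_ge0// exprn_ge0// ltW.
  move: (2^-1 ^+ n) p0 => p p0 q0; nra.
rewrite (_ : f (z + h) - f z - d * h = (s2 - s1 - h * s3) - (s2 - f (z + h)) + (s1 - f z) + h * (s3 - d)); last by ring.
have t1 := cmodD ((s2 - s1 - h * s3) - (s2 - f (z + h)) + (s1 - f z)) (h * (s3 - d)).
have t2 := cmodD ((s2 - s1 - h * s3) - (s2 - f (z + h))) (s1 - f z).
have t3 := cmodD (s2 - s1 - h * s3) (- (s2 - f (z + h))).
rewrite cmodN in t3; rewrite cmodM in t1.
have : cmod h * cmod (s3 - d) <= cmod h * (4 * (L * (cmod w)^-1 ^+ 2) * 2^-1 ^+ n).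
  by rewrite ler_wpM2l// cmod_ge0.
lra.
Qed.

End Kernel_series.

(** * The zigzag path between a base point and its targets *)

Definition zstep (s : nat * nat) : nat * nat :=
  if (s.2 < s.1.*2)%N then (s.1, s.2.+1) else (s.1.+1, 0%N).
(** A state (m, i) is the position i in the m-th excursion, which runs through i = 0, ..., 2m. *)
Definition zwalk (j : nat) : nat * nat := iter j zstep (0%N, 0%N).
(** The profile of an excursion is a tent: up from 0 to m, then back to 0. *)
Definition zheight (j : nat) : nat := minn (zwalk j).2 ((zwalk j).1.*2 - (zwalk j).2).

Lemma zwalk_bound j : ((zwalk j).2 <= (zwalk j).1.*2)%N.
Proof.
elim: j => [|j]; first by [].
rewrite /zwalk iterS -/(zwalk j) /zstep.
by case: ifP => //= h _.
Qed.

(** The excursion number, hence the target, changes only between two states of height 0, where the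
    path is at the base point whatever the target. *)
Lemma zheight_step j : [/\ (zheight j.+1 <= (zheight j).+1)%N,
  (zheight j <= (zheight j.+1).+1)%N &
  (zwalk j.+1).1 = (zwalk j).1 \/ (zheight j = 0%N /\ zheight j.+1 = 0%N)].
Proof.
have := zwalk_bound j; rewrite /zheight /zwalk iterS -/(zwalk j) /zstep.
by case: (zwalk j) => m i /=; case: ifP => /= h1 h2; split; lia.
Qed.

Lemma zheight_lip j k : (zheight (j + k) <= zheight j + k)%N /\
  (zheight j <= zheight (j + k) + k)%N.
Proof.
elim: k => [|k [ih1 ih2]]; first by rewrite !addn0.
by have [h1 h2 _] := zheight_step (j + k); rewrite addnS; split; lia.
Qed.

Lemma zwalk_reach m i : (i <= m.*2)%N -> exists J, zwalk J = (m, i).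
Proof.
elim: m i => [|m ihm]; elim=> [|i ihi] h.
- by exists 0%N.
- lia.
- have [|J EJ] := ihm m.*2; first lia.
  by exists J.+1; rewrite /zwalk iterS -/(zwalk J) EJ /zstep ltnn.
- have [|J EJ] := ihi; first lia.
  by exists J.+1; rewrite /zwalk iterS -/(zwalk J) EJ /zstep ifT.
Qed.

Section Zigzag.
Local Open Scope complex_scope.
Variables (R : realType).
Local Notation C := (R[i])^o.

(** Compared with the telescoping sum that ends at [c J], the term J + k has a surplus factor of at
    most 2^-k and the term J - k a defect factor of at most 2 / 2^k. Steps growing like (4/3)^k away
    from J leave geometric series of ratio 2/3: 4 E from the terms before J and 3 E from the
    others. *)
Lemma kern_series_near (c : nat -> C) (E : R) (J : nat) (w : C) : 0 < complex.Re w ->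
  1 <= 2 ^+ J * cmod w <= 2 ->
  (forall k, cmod (c (J + k).+1 - c (J + k)%N) <= E * (4 / 3) ^+ k) ->
  (forall j k, (j + k)%N = J -> cmod (c j.+1 - c j) <= E * (4 / 3) ^+ k) ->
  forall k, cmod (c 0%N + \sum_(j < J + k) (c j.+1 - c j) * kern j w - c J) <= 7 * E.
Proof.
move=> w0 /andP[J1 J2] Hr Hl.
have E0 : 0 <= E by have := le_trans (cmod_ge0 _) (Hr 0%N); rewrite expr0 mulr1.
have c0 := cmod_gt0 w0.
have inv2 k : (2 : R) ^+ k * 2^-1 ^+ k = 1 by rewrite -exprMn divff// expr1n.
have gr k : cmod (kern (J + k) w) <= 2^-1 ^+ k.
  apply: le_trans (kern_le _ w0) _; rewrite exprD mulrA ler_piMl ?exprn_ge0//.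
  have -> : (cmod w)^-1 * 2^-1 ^+ J = (2 ^+ J * cmod w)^-1 by rewrite exprVn -invfM mulrC.
  by rewrite invf_le1// (lt_le_trans ltr01 J1).
have gl j k : (j + k)%N = J -> cmod (kern j w - 1) <= 2 * 2^-1 ^+ k.
  move=> jk; apply: le_trans (kern_sub1_le _ w0) _.
  move: J2; rewrite -jk exprD => J2.
  rewrite -(ler_pM2r (x := 2 ^+ k)) ?exprn_gt0//.
  by rewrite -[leRHS]mulrA (mulrC (2^-1 ^+ k)) inv2 mulr1 mulrAC.
have e23 k : (4 / 3 : R) ^+ k * 2^-1 ^+ k = (2 / 3) ^+ k.
  by rewrite -exprMn; congr (_ ^+ _); field.
have part1 i : (i <= J)%N ->
    cmod (c 0%N + \sum_(j < i) (c j.+1 - c j) * kern j w - c i) <= 4 * E * (2 / 3) ^+ (J - i).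
  elim: i => [|i ih] iJ.
    rewrite big_ord0 addr0 subrr {1}/cmod ComplexField.Normc.normc0.
    by rewrite mulr_ge0 ?exprn_ge0// ?mulr_ge0// divr_ge0.
  rewrite big_ord_recr/=.
  rewrite (_ : _ - _ = (c 0%N + \sum_(j < i) (c j.+1 - c j) * kern j w - c i) +
     (c i.+1 - c i) * (kern i w - 1)); last by ring.
  apply: le_trans (cmodD _ _) _; rewrite cmodM.
  have iJ' : (i + (J - i))%N = J by lia.
  have := ler_pM (cmod_ge0 _) (cmod_ge0 _) (Hl _ _ iJ') (gl _ _ iJ').
  rewrite (_ : _ * (4 / 3) ^+ _ * _ = 2 * E * ((4 / 3) ^+ (J - i) * 2^-1 ^+ (J - i))); last by ring.
  rewrite e23; have := ih (ltnW iJ).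
  rewrite (_ : (J - i)%N = (J - i.+1).+1); last lia.
  rewrite exprS; lra.
have part2 k : cmod (c 0%N + \sum_(j < J + k) (c j.+1 - c j) * kern j w - c J) <=
    4 * E + 3 * E * (1 - (2 / 3) ^+ k).
  elim: k => [|k ih].
    by have := part1 J (leqnn _); rewrite addn0 subnn !expr0; lra.
  rewrite addnS big_ord_recr/=.
  rewrite (_ : _ - _ = (c 0%N + \sum_(j < J + k) (c j.+1 - c j) * kern j w - c J) +
     (c (J + k).+1 - c (J + k)%N) * kern (J + k) w); last by ring.
  apply: le_trans (cmodD _ _) _; rewrite cmodM.
  have := ler_pM (cmod_ge0 _) (cmod_ge0 _) (Hr k) (gr k).
  rewrite -(mulrA E) e23 exprS; lra.
move=> k; apply: le_trans (part2 k) _.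
have : 0 <= (2 / 3 : R) ^+ k by rewrite exprn_ge0// divr_ge0.
by move: (_ ^+ k) => x x0; nra.
Qed.

(** A step at height h has length at most U (1 - q) q^h, up to the factor 1/q <= 4/3 on the way
    down. Heights at indices k apart differ by at most k, so q^h grows by at most (4/3)^k, which is
    what [kern_series_near] tolerates. *)
Lemma zpath_estimates (s0 : C) (u : nat -> C) (U q : R) : 3 / 4 <= q -> q < 1 ->
  (forall m, cmod (u m) <= U) ->
  let c j := s0 + (1 - q ^+ zheight j)%:C * u (zwalk j).1 in
  (forall J, let E := U * (1 - q) * (4 / 3) * q ^+ zheight J in
    (forall k, cmod (c (J + k).+1 - c (J + k)%N) <= E * (4 / 3) ^+ k) /\
    (forall j k, (j + k)%N = J -> cmod (c j.+1 - c j) <= E * (4 / 3) ^+ k)).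
Proof.
move=> q34 q1 uU c J E.
have q0 : 0 < q by lra.
have U0 : 0 <= U by apply: le_trans (uU 0%N); exact: cmod_ge0.
have step j : cmod (c j.+1 - c j) <= U * (1 - q) * (4 / 3) * q ^+ zheight j.
  have [h1 h2 h3] := zheight_step j.
  have R0 : 0 <= U * (1 - q) * (4 / 3) * q ^+ zheight j.
    have q1' : 0 <= 1 - q by lra.
    by rewrite !mulr_ge0 ?exprn_ge0 ?(ltW q0)//; lra.
  case: h3 => [lab|[z1 z2]]; last first.
    by move: R0; rewrite /c z1 z2 !expr0 (subrr (1 : R)) rmorph0 !mul0r subrr {1}/cmod ComplexField.Normc.normc0.
  have -> : c j.+1 - c j = (q ^+ zheight j - q ^+ zheight j.+1)%:C * u (zwalk j).1.
    by rewrite /c lab !rmorphB; ring.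
  rewrite cmodM cmod_real.
  have qh : 0 < q ^+ zheight j by exact: exprn_gt0.
  have : `|q ^+ zheight j - q ^+ zheight j.+1| <= (1 - q) * (4 / 3) * q ^+ zheight j.
    have [e|[e|e]] : zheight j.+1 = (zheight j).+1 \/ zheight j.+1 = zheight j \/
       zheight j = (zheight j.+1).+1 by lia.
    - rewrite e exprS; move: (q ^+ zheight j) qh => x x0.
      by rewrite ger0_norm; nra.
    - rewrite e subrr normr0; apply: mulr_ge0; [lra|exact: ltW].
    - have := exprn_gt0 (zheight j.+1) q0; rewrite e exprS.
      move: (q ^+ zheight j.+1) => x x0.
      have h : 0 <= (1 - q) * x * (4 / 3 * q - 1).
        by apply: mulr_ge0; [apply: mulr_ge0; [lra|exact: ltW]|lra].
      by rewrite ler0_norm; nra.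
  move=> h; have := ler_pM (normr_ge0 _) (cmod_ge0 _) h (uU (zwalk j).1).
  lra.
have cmp j k : (zheight J <= zheight j + k)%N -> q ^+ zheight j <= q ^+ zheight J * (4 / 3) ^+ k.
  move=> h.
  have e1 : q ^+ (zheight j + k) <= q ^+ zheight J by apply: ler_wiXn2l; rewrite ?(ltW q0) ?(ltW q1).
  rewrite exprD in e1.
  have e2 : 1 <= (q * (4 / 3)) ^+ k by rewrite exprn_ege1//; lra.
  rewrite exprMn in e2.
  have p1 : 0 <= (4 / 3 : R) ^+ k by rewrite exprn_ge0// divr_ge0.
  have p2 : 0 < q ^+ zheight j by exact: exprn_gt0.
  move: (q ^+ zheight j) (q ^+ zheight J) (q ^+ k) ((4 / 3) ^+ k) e1 e2 p1 p2 => a b x y.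
  move=> e1 e2 y0 a0; have : a * (x * y) >= a by rewrite ler_peMr// ltW.
  have : a * x * y <= b * y by rewrite ler_wpM2r.
  lra.
have fin j k : (zheight J <= zheight j + k)%N -> cmod (c j.+1 - c j) <= E * (4 / 3) ^+ k.
  move=> /cmp h; apply: le_trans (step j) _; rewrite /E -[leRHS]mulrA ler_wpM2l//.
  by apply: mulr_ge0; [apply: mulr_ge0 => //; lra|lra].
split=> [k|j k jk]; apply: fin.
  by have [] := zheight_lip J k.
by rewrite -jk; have [] := zheight_lip j k.
Qed.

End Zigzag.

(** * Construction of the symbol from a dense sequence of targets *)

Section Symbol.
Local Open Scope complex_scope.
Variables (R : realType).
Local Notation C := (R[i])^o.

(** An enumeration of the points with rational coordinates, in which those outside [S] are replaced
    by a fixed point of [S]. *)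
Lemma dense_sequence (S : set C) : S !=set0 -> open S ->
  exists p : nat -> C, (forall k, S (p k)) /\
    (forall s e, S s -> 0 < e -> exists k, cmod (p k - s) <= e).
Proof.
move=> [s0 Ss0] oS.
pose pt (ab : rat * rat) : C := ratr ab.1 +i* ratr ab.2.
pose p (k : nat) : C := if unpickle k is Some ab then
  (if `[< S (pt ab) >] then pt ab else s0) else s0.
exists p; split=> [k|s e Ss e0].
  by rewrite /p; case: (unpickle k) => // ab; case: asboolP.
have [r r0 rS] : exists2 r : R, 0 < r & forall z', cmod (z' - s) < r -> S z'.
  by apply/nbhsC; move: oS; rewrite openE => /(_ _ Ss).
pose m := Num.min r e; have m0 : 0 < m by rewrite lt_min r0.
have near (x : R) : exists q : rat, `|ratr q - x| < m / 2.
  have /rat_in_itvoo[q qx] : x - m / 2 < x + m / 2 by lra.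
  exists q; move: qx; rewrite in_itv/= ltr_norml => /andP[? ?].
  by apply/andP; split; lra.
have [a ha] := near (complex.Re s); have [b hb] := near (complex.Im s).
have h : cmod (pt (a, b) - s) < m.
  apply: le_lt_trans (cmod_le_ReIm _) _; rewrite !raddfB/=; lra.
exists (pickle (a, b)); rewrite /p pickleK ifT.
  by apply: ltW; apply: lt_le_trans h _; rewrite ge_min lexx orbT.
by apply/asboolP/rS; apply: lt_le_trans h _; rewrite ge_min lexx.
Qed.

Lemma exists_symbol (S : set C) : S !=set0 -> open S -> bounded_setC S -> convex_setC S ->
  exists psi : C -> C, [/\ analytic_on (@udisc R) psi,
    forall z, udisc z -> S (psi z) &
    forall s e, S s -> 0 < e -> exists om d, [/\ cmod om = 1, 0 < d, d <= 1 &
      forall z, udisc z -> cmod (z - om) < d -> cmod (psi z - s) <= e]].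
Proof.
move=> S0 oS [M SM] cS.
have [p [pS pd]] := dense_sequence S0 oS.
have [s0 Ss0] := S0.
have [rho rho0 rhoS] : exists2 r : R, 0 < r & forall z', cmod (z' - s0) < r -> S z'.
  by apply/nbhsC; move: oS; rewrite openE => /(_ _ Ss0).
pose U := 1 + 2 * M.
have M0 : 0 <= M by apply: le_trans (SM _ Ss0); exact: cmod_ge0.
have U0 : 0 < U by rewrite /U; lra.
(* [logn 2] takes every value k at arbitrarily large m, so each target is approached to any
   precision. *)
pose u m := p (logn 2 m) - s0.
have uU m : cmod (u m) <= U.
  apply: le_trans (cmodD _ _) _; rewrite cmodN /U.
  by have := SM _ Ss0; have := SM _ (pS (logn 2 m)); lra.
(* t = 1 - q. The bound 1/4 gives q >= 3/4; the constant 20 is twice the 10 of [psiJ], which keeps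
   the error strictly below rho q^h. *)
pose t := Num.min (1 / 4) (rho / (20 * U)).
have t0 : 0 < t by rewrite lt_min divr_gt0//= divr_gt0// mulr_gt0.
have t14 : t <= 1 / 4 by rewrite ge_min lexx.
have tU : 20 * U * t <= rho.
  rewrite mulrC -ler_pdivlMr ?mulr_gt0//; by rewrite ge_min lexx orbT.
pose q := 1 - t.
have q34 : 3 / 4 <= q by rewrite /q; lra.
have q1 : q < 1 by rewrite /q; lra.
have q0 : 0 < q by lra.
pose c j := s0 + (1 - q ^+ zheight j)%:C * u (zwalk j).1.
have est := @zpath_estimates R s0 u U q q34 q1 uU; rewrite -/c /= in est.
have qn n : 0 < q ^+ n <= 1 by rewrite exprn_gt0//= exprn_ile1// ltW.
have cb j : cmod (c j - s0) <= U.
  rewrite /c addrC addKr cmodM cmod_real.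
  have /andP[h1 h2] := qn (zheight j).
  rewrite ger0_norm ?subr_ge0//.
  apply: le_trans (uU (zwalk j).1); rewrite ler_piMl ?cmod_ge0//; lra.
have [|f [df fP]] := @kern_series R (fun j => c j.+1 - c j) (2 * U).
  move=> j; have := cmodD (c j.+1 - s0) (- (c j - s0)).
  rewrite cmodN opprB addrA subrK; have := cb j; have := cb j.+1; lra.
pose psi z := c 0%N + f z.
(* The constant 10 rounds up 7 times 4/3, from [kern_series_near] and [zpath_estimates]. *)
have psiJ z J : udisc z -> 1 <= 2 ^+ J * cmod (1 - z) <= 2 ->
    cmod (psi z - c J) <= 10 * U * t * q ^+ zheight J.
  move=> Dz zJ.
  have w0 : 0 < complex.Re (1 - z).
    rewrite raddfB/= subr_gt0; apply: le_lt_trans Dz.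
    by apply: le_trans (Re_le_cmod _); exact: ler_norm.
  have [A HA] := fP _ Dz.
  have [h1 h2] := est J.
  have ks := kern_series_near w0 zJ h1 h2.
  apply: (@le_half_pow _ _ _ A) => n.
  have Hn := HA (J + n)%N.
  have A0 : 0 <= A.
    by have := le_trans (cmod_ge0 _) (HA 0%N); rewrite expr0 mulr1.
  have h3 : A * 2^-1 ^+ (J + n) <= A * 2^-1 ^+ n.
    by rewrite exprD ler_wpM2l// ler_piMl ?exprn_ge0// exprn_ile1//; lra.
  have := ks n; set Sg := \sum_(j < J + n) _ in Hn *; move=> hk.
  have := cmodD (c 0%N + Sg - c J) (- (Sg - f z)).
  rewrite cmodN (_ : c 0%N + Sg - c J - (Sg - f z) = psi z - c J); last by rewrite /psi; ring.
  have q' : 1 - q = t by rewrite /q; ring.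
  rewrite q' in hk.
  have /andP[qh _] := qn (zheight J).
  have : 0 <= U * t * q ^+ zheight J by rewrite !mulr_ge0// ltW.
  lra.
exists psi; split.
- move=> z Dz; apply: derivableD; [exact: derivable_cst|exact: df].
- move=> z Dz.
  have c0 : 0 < cmod (1 - z).
    apply: lt_le_trans (Re_le_cmod _); rewrite gtr0_norm raddfB/= subr_gt0;
      (apply: le_lt_trans Dz; apply: le_trans (Re_le_cmod _); exact: ler_norm).
  have c2 : cmod (1 - z) <= 2.
    apply: le_trans (cmodD _ _) _; rewrite cmodN {1}/cmod ComplexField.Normc.normc1.
    by move: Dz; rewrite /udisc/=; lra.
  (* The scale of z is the least such J. Minimality gives the upper bound 2 when J > 0, and |1 - z|
     <= 2 gives it when J = 0. *)
  have exJ : exists J, 1 <= 2 ^+ J * cmod (1 - z).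
    exists (Num.truncn (cmod (1 - z))^-1).+1.
    rewrite -ler_pdivrMr// div1r; apply: le_trans (ltW (truncnS_gt _)) _.
    by rewrite -natrX ler_nat ltnW// ltn_expl.
  pose J := ex_minn exJ.
  have zJ : 1 <= 2 ^+ J * cmod (1 - z) <= 2.
    rewrite /J; case: ex_minnP => -[|j] -> /= jmin; first by rewrite expr0 mul1r.
    have : ~~ (1 <= 2 ^+ j * cmod (1 - z)) by apply/negP => /jmin; rewrite ltnn.
    by rewrite -ltNge exprS; lra.
  have hJ := psiJ z J Dz zJ.
  set x := q ^+ zheight J in hJ.
  have /andP[x0 x1] := qn (zheight J); rewrite -/x in x0 x1.
  pose v := psi z - c J.
  (* The homothety of ratio x centred at the target maps s0 to c J. Seen through it, the error v is
     magnified to v / x, still shorter than rho, so [psi z] is a convex combination of a point of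
     the disc around s0 and the target. *)
  have -> : psi z = x%:C * (s0 + v / x%:C) + (1 - x)%:C * (s0 + u (zwalk J).1).
    have xC : x%:C != 0 :> C by rewrite gt_eqF// ltcR.
    rewrite mulrDr (mulrCA x%:C) divff// mulr1 /v /c -/x rmorphB rmorph1; ring.
  apply: cS; last by rewrite (ltW x0).
    apply: rhoS; rewrite addrAC subrr add0r cmodM cmodV cmod_real gtr0_norm// ltr_pdivrMr//.
    apply: le_lt_trans hJ _.
    have : 0 < U * t * x by rewrite !mulr_gt0.
    have : 20 * U * t * x <= rho * x by rewrite ler_wpM2r// ltW.
    lra.
  by rewrite /u addrCA subrr addr0.
- move=> s e Ss e0.
  have [k hk] := pd s (e / 2) Ss ltac:(by rewrite divr_gt0).
  have [n hn] : exists n, q ^+ n * (U + 10 * U * t) <= 1 ^+ n * (e / 2).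
    by apply: exp_ratio_small => //; rewrite divr_gt0.
  rewrite expr1n mul1r in hn.
  (* The 2-adic valuation k selects the target [p k], and m >= n makes the excursion high enough. *)
  pose m := (2 ^ k * 3 ^ n)%N.
  have mk : logn 2 m = k.
    by rewrite /m lognM ?expn_gt0// lognX logn_prime// lognX logn_prime//= muln1 muln0 addn0.
  have nm : (n <= m)%N.
    rewrite /m; apply: leq_trans (ltnW (ltn_expl n (isT : 1 < 3)%N)) _.
    by rewrite leq_pmull// expn_gt0.
  have [J EJ] := @zwalk_reach m m ltac:(by rewrite -addnn leq_addr).
  have hJ : zheight J = m by rewrite /zheight EJ /= -addnn addnK minnn.
  have qm : q ^+ m <= q ^+ n by apply: ler_wiXn2l; rewrite ?(ltW q0) ?(ltW q1).
  have cs : cmod (c J - s) <= q ^+ m * U + e / 2.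
    rewrite (_ : c J - s = - ((q ^+ m)%:C * u m) + (p k - s)); last first.
      by rewrite /c hJ EJ /= {1}/u mk rmorphB rmorph1 /u mk; ring.
    apply: le_trans (cmodD _ _) _; apply: lerD => //.
    have /andP[x0 _] := qn m.
    by rewrite cmodN cmodM cmod_real gtr0_norm// ler_wpM2l// ltW.
  (* The boundary point om = 1 - w is taken at distance r from 1, in the middle of the scale J:
     moving by less than 2^-J / 2 keeps |1 - z| between 2^-J and twice 2^-J. The real part r^2 / 2
     of w is forced by |w| = r and |1 - w| = 1. *)
  pose r : R := 3 / 2 * 2^-1 ^+ J.
  have pJ : 0 < (2^-1 : R) ^+ J <= 1 by rewrite exprn_gt0//= exprn_ile1//; lra.
  case/andP: pJ => pJ0 pJ1.
  have r4 : 0 <= 1 - r ^+ 2 / 4 by rewrite /r; move: (2^-1 ^+ J) pJ0 pJ1 => x x0 x1; nra.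
  pose w : C := (r ^+ 2 / 2) +i* (r * Num.sqrt (1 - r ^+ 2 / 4)).
  have wr : cmod w = r.
    have r0 : 0 <= r by rewrite mulr_ge0 ?(ltW pJ0)//; lra.
    apply: (pexpIrn (ltn0Sn 1)); rewrite ?nnegrE ?cmod_ge0// cmod_sq/= (exprMn _ r (Num.sqrt _)) sqr_sqrtr//.
    by field.
  have om1 : cmod (1 - w) = 1.
    apply: (pexpIrn (ltn0Sn 1)); rewrite ?nnegrE ?cmod_ge0// cmod_sq/= sub0r sqrrN (exprMn _ r (Num.sqrt _)) sqr_sqrtr//.
    by field.
  exists (1 - w), (2^-1 ^+ J / 2); split; [exact: om1|by rewrite divr_gt0|lra|].
  move=> z Dz zd.
  have zJ : 1 <= 2 ^+ J * cmod (1 - z) <= 2.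
    have a1 := cmodD (1 - z) (z - (1 - w)).
    have a2 := cmodD w (- (z - (1 - w))).
    rewrite (_ : 1 - z + (z - (1 - w)) = w) in a1; last by ring.
    rewrite (_ : w - (z - (1 - w)) = 1 - z) ?cmodN in a2; last by ring.
    rewrite wr in a1 a2.
    have j1 : 2^-1 ^+ J <= cmod (1 - z) by move: a1; rewrite /r; lra.
    have j2 : cmod (1 - z) <= 2 * 2^-1 ^+ J by move: a2; rewrite /r; lra.
    have inv : (2 : R) ^+ J * 2^-1 ^+ J = 1 by rewrite -exprMn divff// expr1n.
    have tJ : 0 < (2 : R) ^+ J by exact: exprn_gt0.
    apply/andP; split.
      apply: (@le_trans _ _ (2 ^+ J * 2^-1 ^+ J)); first by rewrite inv.
      by rewrite ler_wpM2l// ltW.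
    apply: (@le_trans _ _ (2 ^+ J * (2 * 2^-1 ^+ J))); first by rewrite ler_wpM2l// ltW.
    by rewrite mulrCA inv mulr1.
  have := psiJ z J Dz zJ; rewrite hJ => hh.
  have := cmodD (psi z - c J) (c J - s); rewrite addrA subrK.
  have : q ^+ m * (U + 10 * U * t) <= q ^+ n * (U + 10 * U * t).
    by rewrite ler_wpM2r// addr_ge0 ?mulr_ge0 ?(ltW U0) ?(ltW t0).
  lra.
Qed.

End Symbol.

(** * Multiplication by the symbol: boundedness and numerical range *)

Unset Implicit Arguments.

Theorem theorem3p15 (R : realType) (n : nat) (S : set (R[i])^o) :
  (0 < n)%N ->
  S !=set0 -> open S -> bounded_setC S -> convex_setC S ->
  [set @rootn R n * z | z in S] = S ->
  forall alpha : R, -1 < alpha ->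
  exists (phi psi : (R[i])^o -> (R[i])^o),
    analytic_on (@udisc R) phi /\ (forall z, @udisc R z -> @udisc R (phi z)) /\
    analytic_on (@udisc R) psi /\
    bounded_op alpha (wcomp psi phi) /\
    numrange alpha (wcomp psi phi) = S.
Proof.
move=> _ S0 oS bS cS _ alpha a1.
have [psi [apsi psiS psid]] := exists_symbol S0 oS bS cS.
have [M SM] := bS.
have psiM z : udisc z -> cmod (psi z) <= M by move=> Dz; exact/SM/psiS.
exists (fun z => z), psi; split; first exact: analytic_id.
split; first by [].
split; first exact: apsi.
split.
  split; first by move=> f Lf; have [] := L2aM a1 apsi psiM Lf.
  exists M => f Lf; have [_ nM] := L2aM a1 apsi psiM Lf.
  have M0 : 0 <= M by case: S0 => s Ss; apply: le_trans (SM _ Ss); exact: cmod_ge0.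
  rewrite !bnormE -[M]ger0_norm// -sqrtr_sqr -sqrtrM ?sqr_ge0//.
  exact: ler_wsqrtr.
apply/seteqP; split; first exact: (numrange_sub a1 apsi psiM).
apply: dense_convex_sub oS _.
  by move=> x y t Wx Wy t01; exact: (numrange_convex a1 apsi psiM).
move=> s e Ss e0.
(* Compensates the factor 4 lost in [numrange_peak]. *)
have e4 : 0 < e / 4 by exact: divr_gt0.
have [om [d [om1 d0 d1 near]]] := psid s (e / 4) Ss e4.
have [c Wc ce] := numrange_peak a1 apsi psiM om1 d0 d1 e4 near.
exists c => //; apply: le_trans ce _; lra.
Qed.
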